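(* Let $\alpha\in(0,1]$ and $\beta\in[0,1)$, and let $f(z)=z+\sum_{k=2}^\infty a_k z^k\in\mathcal{G}(\alpha)$. Then for all $n\ge 2$ the section $s_n(z;f)$ is convex of order $\beta$ in the disk $|z|<\rho_{\mathcal{K}}$, where $\rho_{\mathcal{K}}$ is the least positive root in $[0,1)$ of the equation $I_{\alpha,\beta}(\rho)=0$, with $$I_{\alpha,\beta}(\rho)=(1-\rho)^{\alpha}\bigl(\rho(1+\alpha-\beta)-(1-\beta)\bigr)+\alpha\rho\bigl((2-\beta)\rho-(1-\beta)\bigr)-\alpha(1-\beta)(1-\rho)\ln(1-\rho).$$
   Context: Let $\mathbb{D}=\{z\in\mathbb{C}:|z|<1\}$ and let $\mathcal{A}$ be the family of analytic functions $f$ in $\mathbb{D}$ with $f(0)=0$ and $f'(0)=1$, i.e. $f(z)=z+\sum_{k=2}^\infty a_kz^k$. For $\alpha>0$, $\mathcal{G}(\alpha)$ is the class of locally univalent $f\in\mathcal{A}$ (so $f'(z)\ne0$ in $\mathbb{D}$) satisfying $\Re\left(1+\frac{zf''(z)}{f'(z)}\right)<1+\frac{\alpha}{2}$ for all $z\in\mathbb{D}$. The $n$-th section (partial sum) of $f$ is the polynomial $s_n(z;f)=z+\sum_{k=2}^n a_kz^k$. For $0\le\beta<1$, a function $g$ (normalized by $g(0)=0$, $g'(0)=1$) is convex of order $\beta$ in the disk $|z|<r$ if $g'(z)\neq0$ and $\Re\left(1+\frac{zg''(z)}{g'(z)}\right)>\beta$ for all $|z|<r$. *)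

(* Defs.v *)
From Stdlib Require Import Reals.
From Coquelicot Require Import Coquelicot.

Open Scope C_scope.

(* Functions are total on C; only their values on the disk |z| < r matter.
   [ex_derive] is over the scalar field C, i.e. complex differentiability. *)
Definition analytic_in_disk (r : R) (f : C -> C) : Prop :=
  forall z : C, (Cmod z < r)%R -> ex_derive f z.

Definition normalized (f : C -> C) : Prop :=
  f (RtoC 0) = RtoC 0 /\ C_derive f (RtoC 0) = RtoC 1.

Definition class_A (f : C -> C) : Prop :=
  analytic_in_disk 1 f /\ normalized f.

Definition locally_univalent_in_disk (r : R) (f : C -> C) : Prop :=
  forall z0 : C, (Cmod z0 < r)%R ->
    exists e : R, (0 < e)%R /\
      forall z w : C, (Cmod (z - z0) < e)%R -> (Cmod (w - z0) < e)%R ->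
        (Cmod z < r)%R -> (Cmod w < r)%R -> f z = f w -> z = w.

Definition convexity_quotient (f : C -> C) (z : C) : C :=
  RtoC 1 + z * C_derive (C_derive f) z / C_derive f z.

(* Division in C is total, so the nonvanishing of f' is recorded explicitly;
   for analytic f it is equivalent to local univalence. *)
Definition class_G (alpha : R) (f : C -> C) : Prop :=
  class_A f /\
  locally_univalent_in_disk 1 f /\
  forall z : C, (Cmod z < 1)%R ->
    C_derive f z <> RtoC 0 /\
    (Re (convexity_quotient f z) < 1 + alpha / 2)%R.

Definition convex_of_order_in_disk (beta r : R) (g : C -> C) : Prop :=
  analytic_in_disk r g /\ normalized g /\
  forall z : C, (Cmod z < r)%R ->
    C_derive g z <> RtoC 0 /\
    (beta < Re (convexity_quotient g z))%R.

(* For f in class A the coefficients a 0 and a 1 are forced to be 0 and 1. *)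
Definition power_series_expansion (f : C -> C) (a : nat -> C) : Prop :=
  forall z : C, (Cmod z < 1)%R -> is_pseries a z (f z).

Definition partial_section (a : nat -> C) (n : nat) (z : C) : C :=
  z + sum_n_m (fun k : nat => a k * z ^ k) 2 n.

Definition I_fun (alpha beta rho : R) : R :=
  (Rpower (1 - rho) alpha * (rho * (1 + alpha - beta) - (1 - beta))
   + alpha * rho * ((2 - beta) * rho - (1 - beta))
   - alpha * (1 - beta) * (1 - rho) * ln (1 - rho))%R.

Definition is_least_positive_root (F : R -> R) (rho : R) : Prop :=
  (0 < rho < 1)%R /\ F rho = 0%R /\
  forall s : R, (0 < s < 1)%R -> F s = 0%R -> (rho <= s)%R.

(* Main.v *)
Require Import Defs.
From Stdlib Require Import Reals Arith Lra Lia.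
From Coquelicot Require Import Coquelicot.

(** Write h = f' and phi = z h' / h, so that the hypothesis says that h has no zero,
phi(0) = 0 and Re phi < alpha / 2.  Three estimates on h drive the proof.

- Coefficients ([coefficient_bound]): if h = sum b_k z^k then k |b_k| <= alpha.
  For a polynomial H the mean over a circle of (alpha / 2 - Re phi) |H|^2 is nonnegative.
  Take H = b_0 + ... + b_(m-1) z^(m-1) + c z^m.  Since phi h = z h' and phi(0) = 0, the
  coefficients of phi H up to order m are the numbers k b_k, whatever c is, and
  orthogonality of the monomials turns the positivity into
    Re (m b_m conj(c)) <= (alpha / 2) (1 + |c|^2) - sum_(1 <= k < m) (k - alpha / 2) |b_k|^2
  up to powers of the radius, which tends to 1.  Now let c be b_m / |b_m|.
- Growth of phi ([z_log_derivative_bound]): |phi(z)| <= alpha r / (1 - r) for |z| = r.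
  The Schwarz integral formula writes phi(z) as the mean of -2 (alpha / 2 - Re phi) z / (zeta - z)
  over a circle, and the nonnegative weight alpha / 2 - Re phi has mean alpha / 2.
- Lower bound ([half_plane_lower_bound]): |h(z)| >= (1 - r)^alpha, by integrating the
  previous bound along the segment from 0 to z.

Now let s be a section of f of degree n >= 2.  By the coefficient bound
|h - s'| <= A(r) = - alpha ln (1 - r) - alpha r and |z (h' - s'')| <= alpha r^2 / (1 - r).
Hence |s'| >= D(r) = (1 - r)^alpha - A(r), and from
  z s'' / s' = phi + (- z (h' - s'') + phi (h - s')) / s'
one gets, as soon as D(r) > 0,
  Re (1 + z s'' / s') - beta >= - I(r) / ((1 - r) D(r))    ([quotient_estimate], [I_fun_decomp]).
It remains to see that I < 0 and D > 0 on [0, rho) for the least root rho.  With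
r0 = (1 - beta) / (1 - beta + alpha) the decomposition of I shows I(r0) >= 0, while I(0) < 0;
so the least root exists and is at most r0, and for r < rho <= r0 the decomposition and
I(r) < 0 leave no choice but D(r) > 0 ([exists_least_root]).

The circle means rest on one analytic fact, [cauchy_homotopy]: a weighted mean of a
holomorphic function does not change while its circle is contracted to an interior point.
This yields Cauchy's formula and the mean value property, and applies to phi, a quotient of
power series, without knowing beforehand that phi has a power series on the whole disk. *)

Local Open Scope C_scope.

(** * Complex differentiation *)

(** Replaces filters by inequalities between moduli, the form in which the explicit
    estimates for inverses and power series enter. *)
Lemma is_derive_C_epsilon (F : C -> C) (z l : C) :
  is_derive F z l <->
  forall e : R, (0 < e)%R -> exists d : R, (0 < d)%R /\
    forall w : C, (Cmod (w - z) < d)%R ->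
      (Cmod (F w - F z - (w - z) * l) <= e * Cmod (w - z))%R.
Proof.
  split.
  - intros [_ H] e He.
    destruct (H z (fun P H => H) (mkposreal e He)) as [d Hd].
    exists d; split; [apply cond_pos|].
    intros w Hw. exact (Hd w Hw).
  - intros H; split.
    + apply is_linear_scal_l.
    + intros x Hx.
      pose proof (@is_filter_lim_locally_unique _ (AbsRing_NormedModule C_AbsRing) z x Hx) as E; subst x.
      intros e. destruct (H e (cond_pos e)) as [d [Hd Hw]].
      exists (mkposreal d Hd). intros w H'. exact (Hw w H').
Qed.

(** [C] is a normed module over itself in two ways, with the same norm but different
    uniform structures. The product and chain rules are stated for the second one. *)
Lemma is_derive_C_AbsRing (F : C -> C) (z l : C) :
  is_derive (V := C_NormedModule) F z l <->
  is_derive (V := AbsRing_NormedModule C_AbsRing) F z l.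
Proof.
  split; intros [_ H]; (split; [apply is_linear_scal_l | exact H]).
Qed.

Lemma ball_of_Cmod (z w : C) (e : R) :
  (Cmod (w - z) < e)%R -> @ball C_UniformSpace z e w.
Proof. exact (C_NormedModule_mixin_compat1 z w e). Qed.

Lemma Cmod_of_ball (z w : C) (e : posreal) :
  @ball C_UniformSpace z e w -> (Cmod (w - z) < sqrt 2 * e)%R.
Proof. exact (C_NormedModule_mixin_compat2 z w e). Qed.

Lemma continuous_C_epsilon (F : C -> C) (z : C) :
  @continuous C_UniformSpace C_UniformSpace F z <->
  forall e : R, (0 < e)%R -> exists d : R, (0 < d)%R /\
    forall w : C, (Cmod (w - z) < d)%R -> (Cmod (F w - F z) < e)%R.
Proof.
  assert (S2 : (0 < sqrt 2)%R) by (apply sqrt_lt_R0; lra).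
  split.
  - intros H e He.
    assert (He' : (0 < e / sqrt 2)%R) by (apply Rdiv_lt_0_compat; lra).
    destruct (proj1 (filterlim_locally F (F z)) H (mkposreal _ He')) as [d Hd].
    exists d; split; [apply cond_pos|]. intros w Hw.
    specialize (Hd w (ball_of_Cmod _ _ _ Hw)).
    apply Cmod_of_ball in Hd. simpl in Hd.
    replace (sqrt 2 * (e / sqrt 2))%R with e in Hd by (field; lra). exact Hd.
  - intros H. apply filterlim_locally. intros e.
    destruct (H e (cond_pos e)) as [d [Hd Hw]].
    assert (Hd' : (0 < d / sqrt 2)%R) by (apply Rdiv_lt_0_compat; lra).
    exists (mkposreal _ Hd'). intros w Hb.
    apply ball_of_Cmod. apply Hw. apply Cmod_of_ball in Hb. simpl in Hb.
    replace (sqrt 2 * (d / sqrt 2))%R with d in Hb by (field; lra). exact Hb.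
Qed.

Section ContC.
Context {T : UniformSpace}.
Implicit Types f g : T -> C.

Lemma continuous_Re_comp f x :
  @continuous T C_UniformSpace f x -> continuous (fun t => Re (f t)) x.
Proof.
  intros H. apply (continuous_comp f (fun c : C_UniformSpace => fst c) x H).
  apply continuous_fst.
Qed.
Lemma continuous_Im_comp f x :
  @continuous T C_UniformSpace f x -> continuous (fun t => Im (f t)) x.
Proof.
  intros H. apply (continuous_comp f (fun c : C_UniformSpace => snd c) x H).
  apply continuous_snd.
Qed.
Lemma continuous_C_pair f x :
  continuous (fun t => Re (f t)) x -> continuous (fun t => Im (f t)) x ->
  @continuous T C_UniformSpace f x.
Proof.
  intros H1 H2. unfold continuous.
  apply (filterlim_ext (fun t => (Re (f t), Im (f t)))).
  - intros t. symmetry. apply surjective_pairing.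
  - intros P HP.
    assert (HP' : locally (Re (f x), Im (f x)) P).
    { unfold Re, Im. rewrite <- surjective_pairing. exact HP. }
    apply (filterlim_pair (F := locally x) _ _ H1 H2).
    destruct HP' as [e He]. exists (ball (Re (f x)) e) (ball (Im (f x)) e).
    + apply locally_ball.
    + apply locally_ball.
    + intros u v Hu Hv. apply He. split; assumption.
Qed.

Lemma continuous_Cplus f g x :
  @continuous T C_UniformSpace f x -> @continuous T C_UniformSpace g x ->
  @continuous T C_UniformSpace (fun t => f t + g t) x.
Proof.
  intros Hf Hg.
  apply continuous_C_pair; simpl.
  - apply (continuous_plus (fun t => Re (f t)) (fun t => Re (g t)));
      now apply continuous_Re_comp.
  - apply (continuous_plus (fun t => Im (f t)) (fun t => Im (g t)));
      now apply continuous_Im_comp.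
Qed.

Lemma continuous_Copp f x :
  @continuous T C_UniformSpace f x ->
  @continuous T C_UniformSpace (fun t => - f t) x.
Proof.
  intros Hf.
  apply continuous_C_pair; simpl.
  - apply (continuous_opp (fun t => Re (f t))); now apply continuous_Re_comp.
  - apply (continuous_opp (fun t => Im (f t))); now apply continuous_Im_comp.
Qed.

Lemma continuous_Cconj f x :
  @continuous T C_UniformSpace f x ->
  @continuous T C_UniformSpace (fun t => Cconj (f t)) x.
Proof.
  intros Hf.
  apply continuous_C_pair; simpl.
  - now apply continuous_Re_comp.
  - apply (continuous_opp (fun t => Im (f t))); now apply continuous_Im_comp.
Qed.

Lemma continuous_Cmult f g x :
  @continuous T C_UniformSpace f x -> @continuous T C_UniformSpace g x ->
  @continuous T C_UniformSpace (fun t => f t * g t) x.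
Proof.
  intros Hf Hg.
  pose proof (continuous_Re_comp f x Hf). pose proof (continuous_Im_comp f x Hf).
  pose proof (continuous_Re_comp g x Hg). pose proof (continuous_Im_comp g x Hg).
  apply continuous_C_pair; simpl.
  - apply (continuous_minus (fun t => Re (f t) * Re (g t))%R (fun t => Im (f t) * Im (g t))%R);
      apply (continuous_mult (K := R_AbsRing)); assumption.
  - apply (continuous_plus (fun t => Re (f t) * Im (g t))%R (fun t => Im (f t) * Re (g t))%R);
      apply (continuous_mult (K := R_AbsRing)); assumption.
Qed.

End ContC.

Lemma Cinv_taylor (x w : C) : w <> 0 -> x <> 0 ->
  / w - / x - (w - x) * (- / (x * x)) = (w - x) * (w - x) / (w * x * x).
Proof. intros. field. auto. Qed.

Lemma Cmod_lower (a b : C) : (Cmod a - Cmod (b - a) <= Cmod b)%R.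
Proof.
  pose proof (Cmod_triangle b (a - b)) as H.
  replace (b + (a - b)) with a in H by ring.
  replace (a - b) with (- (b - a)) in H by ring. rewrite Cmod_opp in H. lra.
Qed.

(** The remainder is the explicit fraction of [Cinv_taylor]; near [x] its denominator
    stays above half of its value at [x]. *)
Lemma is_derive_Cinv (x : C) : x <> 0 -> is_derive Cinv x (- / (x * x)).
Proof.
  intros Hx. apply is_derive_C_epsilon. intros e He.
  pose proof (proj1 (Cmod_gt_0 x) Hx) as P. set (m := Cmod x) in *.
  exists (Rmin (m / 2) (e * m * m * m / 2)). split.
  { apply Rmin_case. lra. apply Rmult_lt_0_compat; [|lra].
    repeat apply Rmult_lt_0_compat; lra. }
  intros w Hw.
  pose proof (Rlt_le_trans _ _ _ Hw (Rmin_l _ _)) as H1.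
  pose proof (Rlt_le_trans _ _ _ Hw (Rmin_r _ _)) as H2.
  pose proof (Cmod_lower x w) as L. fold m in L.
  assert (Hw0 : w <> 0). { intro E. subst w. rewrite Cmod_0 in L. lra. }
  rewrite Cinv_taylor by assumption.
  rewrite Cmod_div by (repeat apply Cmult_neq_0; assumption).
  rewrite !Cmod_mult. fold m. set (d := Cmod (w - x)) in *.
  assert (0 <= d)%R by apply Cmod_ge_0.
  apply Rle_div_l.
  { apply Rlt_gt. repeat apply Rmult_lt_0_compat; lra. }
  replace (e * d * (Cmod w * m * m))%R with (d * (e * m * m * Cmod w))%R by ring.
  apply Rmult_le_compat_l; [lra|].
  assert (Q : (0 < e * m * m)%R) by (repeat apply Rmult_lt_0_compat; lra).
  nra.
Qed.

Lemma is_derive_C_continuous (F : C -> C) z l :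
  is_derive F z l -> @continuous C_UniformSpace C_UniformSpace F z.
Proof.
  intros H. apply continuous_C_epsilon. intros e He.
  destruct (proj1 (is_derive_C_epsilon F z l) H 1%R Rlt_0_1) as [d [Hd Hw]].
  pose proof (Cmod_ge_0 l) as Hl.
  exists (Rmin d (e / (1 + Cmod l))). split.
  { apply Rmin_case; [lra|]. apply Rdiv_lt_0_compat; lra. }
  intros w H'.
  pose proof (Rlt_le_trans _ _ _ H' (Rmin_l _ _)) as H1.
  pose proof (Rlt_le_trans _ _ _ H' (Rmin_r _ _)) as H2.
  specialize (Hw w H1).
  apply Rlt_div_r in H2; [|lra].
  replace (F w - F z) with ((F w - F z - (w - z) * l) + (w - z) * l) by ring.
  eapply Rle_lt_trans; [apply Cmod_triangle|]. rewrite Cmod_mult. lra.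
Qed.

Lemma continuous_Cinv_comp {T : UniformSpace} (f : T -> C) x :
  @continuous T C_UniformSpace f x -> f x <> 0 ->
  @continuous T C_UniformSpace (fun t => / f t) x.
Proof.
  intros Hf H. apply (continuous_comp f Cinv x Hf).
  eapply is_derive_C_continuous. now apply is_derive_Cinv.
Qed.

Lemma is_derive_Cmult (f g : C -> C) z df dg :
  is_derive f z df -> is_derive g z dg ->
  is_derive (fun w => f w * g w) z (df * g z + f z * dg).
Proof.
  intros Hf Hg.
  apply is_derive_C_AbsRing in Hf. apply is_derive_C_AbsRing in Hg.
  apply is_derive_C_AbsRing.
  exact (is_derive_mult (K := C_AbsRing) f g z df dg Hf Hg Cmult_comm).
Qed.

Lemma is_derive_Cplus (f g : C -> C) z (df dg : C) :
  is_derive f z df -> is_derive g z dg ->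
  is_derive (fun w => f w + g w) z (df + dg).
Proof.
  intros Hf Hg.
  exact (is_derive_plus (K := C_AbsRing) f g z df dg Hf Hg).
Qed.

Lemma is_derive_Cinv_comp (f : C -> C) z df :
  is_derive f z df -> f z <> 0 ->
  is_derive (fun w => / f w) z (df * (- / (f z * f z))).
Proof.
  intros Hf H.
  apply is_derive_C_AbsRing in Hf.
  exact (is_derive_comp (K := C_AbsRing) Cinv f z _ df (is_derive_Cinv _ H) Hf).
Qed.

(** Continuity of the derivative is what differentiation under an integral sign requires;
    sums, products and quotients of power series have it. *)
Definition holC1 (rho : R) (F F' : C -> C) : Prop :=
  forall z : C, (Cmod z < rho)%R ->
    is_derive F z (F' z) /\ @continuous C_UniformSpace C_UniformSpace F' z.

Lemma holC1_continuous rho F F' z : holC1 rho F F' -> (Cmod z < rho)%R ->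
  @continuous C_UniformSpace C_UniformSpace F z.
Proof. intros H Hz. destruct (H z Hz) as [H1 _]. eapply is_derive_C_continuous, H1. Qed.

Lemma holC1_const rho (c : C) : holC1 rho (fun _ => c) (fun _ => 0).
Proof.
  intros z _; split.
  - exact (is_derive_const (K := C_AbsRing) (V := C_NormedModule) c z).
  - apply continuous_const.
Qed.

Lemma holC1_id rho : holC1 rho (fun z => z) (fun _ => 1).
Proof.
  intros z _; split.
  - apply is_derive_C_AbsRing. exact (is_derive_id (K := C_AbsRing) z).
  - apply continuous_const.
Qed.

Lemma holC1_plus rho F F' G G' : holC1 rho F F' -> holC1 rho G G' ->
  holC1 rho (fun z => F z + G z) (fun z => F' z + G' z).
Proof.
  intros HF HG z Hz. destruct (HF z Hz), (HG z Hz). split.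
  - now apply is_derive_Cplus.
  - now apply continuous_Cplus.
Qed.

Lemma holC1_mult rho F F' G G' : holC1 rho F F' -> holC1 rho G G' ->
  holC1 rho (fun z => F z * G z) (fun z => F' z * G z + F z * G' z).
Proof.
  intros HF HG z Hz. destruct (HF z Hz), (HG z Hz). split.
  - now apply is_derive_Cmult.
  - pose proof (holC1_continuous _ _ _ z HF Hz). pose proof (holC1_continuous _ _ _ z HG Hz).
    apply continuous_Cplus; now apply continuous_Cmult.
Qed.

Lemma holC1_inv rho F F' : holC1 rho F F' -> (forall z, (Cmod z < rho)%R -> F z <> 0) ->
  holC1 rho (fun z => / F z) (fun z => F' z * (- / (F z * F z))).
Proof.
  intros HF HN z Hz. destruct (HF z Hz). split.
  - now apply is_derive_Cinv_comp; auto.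
  - pose proof (holC1_continuous _ _ _ z HF Hz).
    apply continuous_Cmult; [assumption|]. apply continuous_Copp.
    apply continuous_Cinv_comp; [now apply continuous_Cmult|].
    apply Cmult_neq_0; auto.
Qed.

(** Stated on components, so that the real mean value theorem and the real fundamental
    theorem of calculus apply to each of them. *)
Definition curve_derive (c : R -> C) (s : R) (g : C) : Prop :=
  is_derive (fun u => Re (c u)) s (Re g) /\ is_derive (fun u => Im (c u)) s (Im g).

Lemma is_derive_R_epsilon (f : R -> R) (x l : R) :
  is_derive f x l <->
  forall e : R, (0 < e)%R -> exists d : R, (0 < d)%R /\
    forall w : R, (Rabs (w - x) < d)%R ->
      (Rabs (f w - f x - (w - x) * l) <= e * Rabs (w - x))%R.
Proof.
  split.
  - intros [_ H] e He.
    destruct (H x (fun P H => H) (mkposreal e He)) as [d Hd].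
    exists d; split; [apply cond_pos|].
    intros w Hw. exact (Hd w Hw).
  - intros H; split.
    + apply is_linear_scal_l.
    + intros y Hy.
      pose proof (is_filter_lim_locally_unique x y Hy) as E; subst y.
      intros e. destruct (H e (cond_pos e)) as [d [Hd Hw]].
      exists (mkposreal d Hd). intros w H'. exact (Hw w H').
Qed.

Lemma im_le_Cmod (c : C) : (Rabs (Im c) <= Cmod c)%R.
Proof.
  eapply Rle_trans; [|apply Rmax_Cmod]. apply Rmax_r.
Qed.

Lemma Cmod_le_Re_Im (c : C) : (Cmod c <= Rabs (Re c) + Rabs (Im c))%R.
Proof.
  replace c with (RtoC (Re c) + Ci * RtoC (Im c)) at 1.
  - eapply Rle_trans; [apply Cmod_triangle|].
    rewrite Cmod_mult, !Cmod_R.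
    replace (Cmod Ci) with 1%R; [lra|].
    unfold Cmod, Ci; simpl. replace (0 * (0 * 1) + 1 * (1 * 1))%R with 1%R by ring.
    now rewrite sqrt_1.
  - destruct c as [a b]. unfold RtoC, Ci, Cplus, Cmult, Re, Im; simpl. f_equal; ring.
Qed.

Lemma curve_derive_epsilon (c : R -> C) (s : R) (g : C) :
  curve_derive c s g <->
  forall e : R, (0 < e)%R -> exists d : R, (0 < d)%R /\
    forall u : R, (Rabs (u - s) < d)%R ->
      (Cmod (c u - c s - RtoC (u - s) * g) <= e * Rabs (u - s))%R.
Proof.
  assert (ER : forall u, Re (c u - c s - RtoC (u - s) * g)
     = (Re (c u) - Re (c s) - (u - s) * Re g)%R)
    by (intro; unfold Re, Im, Cminus, Copp, Cplus, Cmult, RtoC; simpl; ring).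
  assert (EI : forall u, Im (c u - c s - RtoC (u - s) * g)
     = (Im (c u) - Im (c s) - (u - s) * Im g)%R)
    by (intro; unfold Re, Im, Cminus, Copp, Cplus, Cmult, RtoC; simpl; ring).
  split.
  - intros [H1 H2] e He.
    destruct (proj1 (is_derive_R_epsilon _ _ _) H1 (e/2)%R ltac:(lra)) as [d1 [D1 W1]].
    destruct (proj1 (is_derive_R_epsilon _ _ _) H2 (e/2)%R ltac:(lra)) as [d2 [D2 W2]].
    exists (Rmin d1 d2); split; [apply Rmin_case; lra|].
    intros u Hu.
    specialize (W1 u (Rlt_le_trans _ _ _ Hu (Rmin_l _ _))).
    specialize (W2 u (Rlt_le_trans _ _ _ Hu (Rmin_r _ _))).
    eapply Rle_trans; [apply Cmod_le_Re_Im|]. rewrite ER, EI. lra.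
  - intros H; split; apply is_derive_R_epsilon; intros e He;
      destruct (H e He) as [d [D W]]; exists d; split; auto; intros u Hu;
      eapply Rle_trans; [|apply (W u Hu)| |apply (W u Hu)].
    + rewrite <- ER. apply re_le_Cmod.
    + rewrite <- EI. apply im_le_Cmod.
Qed.

(** The chain rule through which complex differentiability enters real-variable arguments
    along circles and segments. *)
Lemma curve_derive_comp (F : C -> C) (c : R -> C) (s : R) (l g : C) :
  is_derive F (c s) l -> curve_derive c s g ->
  curve_derive (fun u => F (c u)) s (l * g).
Proof.
  intros HF Hc. apply curve_derive_epsilon. intros e He.
  rewrite is_derive_C_epsilon in HF. rewrite curve_derive_epsilon in Hc.
  pose proof (Cmod_ge_0 g) as Gg. pose proof (Cmod_ge_0 l) as Gl.
  assert (P1 : (0 < e / (2 * (1 + Cmod g)))%R) by (apply Rdiv_lt_0_compat; lra).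
  assert (P2 : (0 < e / (2 * (1 + Cmod l)))%R) by (apply Rdiv_lt_0_compat; lra).
  destruct (HF _ P1) as [d1 [D1 W1]].
  destruct (Hc 1%R Rlt_0_1) as [d2 [D2 W2]].
  destruct (Hc _ P2) as [d3 [D3 W3]].
  exists (Rmin (Rmin d2 d3) (d1 / (1 + Cmod g))). split.
  { repeat apply Rmin_case; try lra. apply Rdiv_lt_0_compat; lra. }
  intros u Hu.
  pose proof (Rlt_le_trans _ _ _ Hu (Rmin_l _ _)) as H12.
  pose proof (Rlt_le_trans _ _ _ Hu (Rmin_r _ _)) as H3.
  specialize (W2 u (Rlt_le_trans _ _ _ H12 (Rmin_l _ _))).
  specialize (W3 u (Rlt_le_trans _ _ _ H12 (Rmin_r _ _))).
  apply Rlt_div_r in H3; [|lra].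
  set (h := Rabs (u - s)) in *. assert (0 <= h)%R by apply Rabs_pos.
  assert (B : (Cmod (c u - c s) <= h * (1 + Cmod g))%R).
  { replace (c u - c s) with ((c u - c s - RtoC (u - s) * g) + RtoC (u-s) * g) by ring.
    eapply Rle_trans; [apply Cmod_triangle|]. rewrite Cmod_mult, Cmod_R. fold h. lra. }
  assert (B' : (Cmod (c u - c s) < d1)%R) by lra.
  specialize (W1 (c u) B').
  replace (F (c u) - F (c s) - RtoC (u - s) * (l * g)) with
    ((F (c u) - F (c s) - (c u - c s) * l) + (c u - c s - RtoC (u - s) * g) * l) by ring.
  eapply Rle_trans; [apply Cmod_triangle|]. rewrite Cmod_mult.
  assert (X1 : (e / (2 * (1 + Cmod g)) * Cmod (c u - c s) <= e / 2 * h)%R).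
  { replace (e / 2 * h)%R with (e / (2 * (1 + Cmod g)) * (h * (1 + Cmod g)))%R by (field; lra).
    apply Rmult_le_compat_l; lra. }
  assert (X2 : (Cmod (c u - c s - RtoC (u - s) * g) * Cmod l <= e / 2 * h)%R).
  { apply Rle_trans with (e / (2 * (1 + Cmod l)) * h * (1 + Cmod l))%R.
    - apply Rmult_le_compat; try lra. apply Cmod_ge_0.
    - right. field. lra. }
  lra.
Qed.

(** * Means over circles and Cauchy's formula *)

Definition rmean (g : R -> R) : R := (RInt g 0 (2 * PI) / (2 * PI))%R.

Definition cmean (c : R -> C) : C :=
  (rmean (fun t => Re (c t)), rmean (fun t => Im (c t))).

Definition rcont (g : R -> R) : Prop := forall t, continuous g t.
Definition ccont (c : R -> C) : Prop :=
  forall t, @continuous R_UniformSpace C_UniformSpace c t.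

Lemma ccont_Re c : ccont c -> rcont (fun t => Re (c t)).
Proof. intros H t. now apply (continuous_Re_comp (T := R_UniformSpace)). Qed.
Lemma ccont_Im c : ccont c -> rcont (fun t => Im (c t)).
Proof. intros H t. now apply (continuous_Im_comp (T := R_UniformSpace)). Qed.
Lemma ccont_plus c d : ccont c -> ccont d -> ccont (fun t => c t + d t).
Proof. intros H1 H2 t. now apply (continuous_Cplus (T := R_UniformSpace)). Qed.
Lemma ccont_mult c d : ccont c -> ccont d -> ccont (fun t => c t * d t).
Proof. intros H1 H2 t. now apply (continuous_Cmult (T := R_UniformSpace)). Qed.
Lemma ccont_conj c : ccont c -> ccont (fun t => Cconj (c t)).
Proof. intros H1 t. now apply (continuous_Cconj (T := R_UniformSpace)). Qed.
Lemma ccont_const (a : C) : ccont (fun _ => a).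
Proof. intros t. apply continuous_const. Qed.

Lemma rcont_ex_RInt g a b : rcont g -> ex_RInt g a b.
Proof. intros H. apply (ex_RInt_continuous (V := R_CompleteNormedModule)). intros; apply H. Qed.

Lemma two_PI_pos : (0 < 2 * PI)%R.
Proof. pose proof PI_RGT_0. lra. Qed.

Lemma rmean_plus g h : rcont g -> rcont h ->
  rmean (fun t => g t + h t)%R = (rmean g + rmean h)%R.
Proof.
  intros Hg Hh. unfold rmean.
  rewrite (RInt_plus (V := R_CompleteNormedModule)) by now apply rcont_ex_RInt.
  unfold plus; simpl. pose proof two_PI_pos. field. apply PI_neq0.
Qed.

Lemma rmean_scal k g : rcont g -> rmean (fun t => k * g t)%R = (k * rmean g)%R.
Proof.
  intros Hg. unfold rmean.
  rewrite (RInt_scal (V := R_CompleteNormedModule)) by now apply rcont_ex_RInt.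
  unfold scal; simpl; unfold mult; simpl. field. apply PI_neq0.
Qed.

Lemma rmean_const k : rmean (fun _ => k) = k.
Proof.
  unfold rmean. rewrite (RInt_const (V := R_CompleteNormedModule)).
  unfold scal; simpl; unfold mult; simpl. field. apply PI_neq0.
Qed.

Lemma rmean_ext g h : (forall t, g t = h t) -> rmean g = rmean h.
Proof. intros H. unfold rmean. f_equal. apply RInt_ext. auto. Qed.

Lemma rmean_le g h : rcont g -> rcont h -> (forall t, g t <= h t)%R ->
  (rmean g <= rmean h)%R.
Proof.
  intros Hg Hh H. unfold rmean. pose proof two_PI_pos.
  apply Rmult_le_compat_r; [left; now apply Rinv_0_lt_compat|].
  apply RInt_le; try (now apply rcont_ex_RInt); auto. lra.
Qed.

Lemma rcont_scal k g : rcont g -> rcont (fun t => k * g t)%R.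
Proof. intros H t. apply (continuous_scal_r k g). apply H. Qed.

Lemma cmean_ext c d : (forall t, c t = d t) -> cmean c = cmean d.
Proof.
  intros H. unfold cmean. f_equal; apply rmean_ext; intro; now rewrite H.
Qed.

Lemma cmean_const a : cmean (fun _ => a) = a.
Proof. unfold cmean. rewrite !rmean_const. destruct a; reflexivity. Qed.

Lemma cmean_plus c d : ccont c -> ccont d ->
  cmean (fun t => c t + d t) = cmean c + cmean d.
Proof.
  intros Hc Hd. unfold cmean, Cplus; simpl. f_equal.
  - apply (rmean_plus (fun t => Re (c t)) (fun t => Re (d t))); now apply ccont_Re.
  - apply (rmean_plus (fun t => Im (c t)) (fun t => Im (d t))); now apply ccont_Im.
Qed.

Lemma cmean_scal a c : ccont c -> cmean (fun t => a * c t) = a * cmean c.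
Proof.
  intros Hc. pose proof (ccont_Re c Hc) as H1. pose proof (ccont_Im c Hc) as H2.
  unfold cmean, Cmult; simpl. f_equal.
  - rewrite (rmean_ext _ (fun t => fst a * Re (c t) + (- snd a) * Im (c t))%R)
      by (intro; unfold Re, Im; simpl; ring).
    rewrite (rmean_plus (fun t => fst a * Re (c t))%R (fun t => (- snd a) * Im (c t))%R)
      by now apply rcont_scal.
    rewrite !rmean_scal by assumption. ring.
  - rewrite (rmean_ext _ (fun t => fst a * Im (c t) + snd a * Re (c t))%R)
      by (intro; unfold Re, Im; simpl; ring).
    rewrite (rmean_plus (fun t => fst a * Im (c t))%R (fun t => snd a * Re (c t))%R)
      by now apply rcont_scal.
    rewrite !rmean_scal by assumption. ring.
Qed.

Lemma cmean_conj c : ccont c -> cmean (fun t => Cconj (c t)) = Cconj (cmean c).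
Proof.
  intros Hc. unfold cmean, Cconj; simpl. f_equal.
  rewrite (rmean_ext _ (fun t => (-1) * Im (c t))%R) by (intro; unfold Im; simpl; ring).
  rewrite rmean_scal by now apply ccont_Im. ring.
Qed.

(** Multiplying by the conjugate of the mean makes the mean real, so that monotonicity of
    the real integral suffices. *)
Lemma Cmod_cmean_le c g : ccont c -> rcont g -> (forall t, Cmod (c t) <= g t)%R ->
  (Cmod (cmean c) <= rmean g)%R.
Proof.
  intros Hc Hg H.
  assert (G0 : (0 <= rmean g)%R).
  { rewrite <- (rmean_const 0). apply rmean_le; auto.
    - intro t. apply continuous_const.
    - intro t. eapply Rle_trans; [apply Cmod_ge_0|apply H]. }
  set (w := cmean c). destruct (Rle_lt_or_eq_dec 0 (Cmod w) (Cmod_ge_0 w)) as [P|E];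
    [|rewrite <- E; exact G0].
  apply (Rmult_le_reg_l (Cmod w)); [exact P|].
  assert (E : (Cmod w * Cmod w)%R = rmean (fun t => Re (Cconj w * c t))).
  { transitivity (Re (cmean (fun t => Cconj w * c t))); [|reflexivity].
    rewrite cmean_scal by assumption. fold w.
    replace (Cconj w * w) with (w * Cconj w) by ring. rewrite <- Cmod2_conj.
    simpl. ring. }
  rewrite E, <- rmean_scal by assumption.
  apply rmean_le.
  - apply ccont_Re, ccont_mult; auto. apply ccont_const.
  - now apply rcont_scal.
  - intro t. eapply Rle_trans; [apply Rle_abs|]. eapply Rle_trans; [apply re_le_Cmod|].
    rewrite Cmod_mult, Cmod_conj. apply Rmult_le_compat_l; auto. apply Cmod_ge_0.
Qed.

Definition circ (r t : R) : C := (r * cos t, r * sin t)%R.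

Lemma Cmod_circ r t : (0 <= r)%R -> Cmod (circ r t) = r.
Proof.
  intros Hr. unfold Cmod, circ; simpl.
  replace (r * cos t * (r * cos t * 1) + r * sin t * (r * sin t * 1))%R
    with ((r * r) * (Rsqr (sin t) + Rsqr (cos t)))%R by (unfold Rsqr; ring).
  rewrite sin2_cos2, Rmult_1_r. now apply sqrt_square.
Qed.

Lemma circ_derive r t : curve_derive (circ r) t (Ci * circ r t).
Proof.
  split; unfold circ, Ci, Cmult, Re, Im; simpl.
  - auto_derive; auto. ring.
  - auto_derive; auto. ring.
Qed.

Lemma ccont_circ r : ccont (circ r).
Proof.
  intro t. destruct (circ_derive r t) as [H1 H2].
  apply (continuous_C_pair (T := R_UniformSpace)).
  - apply (ex_derive_continuous (fun u => Re (circ r u))). eexists; exact H1.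
  - apply (ex_derive_continuous (fun u => Im (circ r u))). eexists; exact H2.
Qed.

Lemma circ_period r : circ r (2 * PI) = circ r 0.
Proof. unfold circ. now rewrite cos_2PI, sin_2PI, cos_0, sin_0. Qed.

Lemma curve_derive_ext (c d : R -> C) s g : (forall u, c u = d u) ->
  curve_derive c s g -> curve_derive d s g.
Proof.
  intros E [H1 H2]; split.
  - apply (is_derive_ext (fun u => Re (c u))); auto. intro; now rewrite E.
  - apply (is_derive_ext (fun u => Im (c u))); auto. intro; now rewrite E.
Qed.

Lemma curve_derive_affine (a b : C) c s g : curve_derive c s g ->
  curve_derive (fun u => a + b * c u) s (b * g).
Proof.
  intros H. apply (curve_derive_comp (fun w => a + b * w) c s b g); auto.
  destruct (holC1_plus (Cmod (c s) + 1) _ _ _ _ (holC1_const _ a)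
    (holC1_mult _ _ _ _ _ (holC1_const _ b) (holC1_id _)) (c s)) as [X _]; [lra|].
  now replace (0 + (0 * c s + b * 1)) with b in X by ring.
Qed.

Lemma cmean_derivative_closed_curve (f : R -> C) (f' : R -> C) :
  (forall t, curve_derive f t (f' t)) -> ccont f' -> f 0%R = f (2 * PI)%R ->
  cmean f' = 0.
Proof.
  intros Hd Hc E. unfold cmean, rmean.
  assert (I1 : RInt (fun t => Re (f' t)) 0 (2 * PI) = 0%R).
  { transitivity (minus (Re (f (2 * PI)%R)) (Re (f 0%R))).
    - apply is_RInt_unique. apply (is_RInt_derive (V := R_CompleteNormedModule) (fun t => Re (f t)));
      intros; [apply Hd | now apply ccont_Re].
    - rewrite E. apply (minus_eq_zero (G := R_AbelianGroup)). }
  assert (I2 : RInt (fun t => Im (f' t)) 0 (2 * PI) = 0%R).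
  { transitivity (minus (Im (f (2 * PI)%R)) (Im (f 0%R))).
    - apply is_RInt_unique. apply (is_RInt_derive (V := R_CompleteNormedModule) (fun t => Im (f t)));
      intros; [apply Hd | now apply ccont_Im].
    - rewrite E. apply (minus_eq_zero (G := R_AbelianGroup)). }
  rewrite I1, I2. unfold RtoC. f_equal; field; apply PI_neq0.
Qed.

Lemma ccont_comp F c : ccont c ->
  (forall t, @continuous C_UniformSpace C_UniformSpace F (c t)) -> ccont (fun t => F (c t)).
Proof. intros Hc HF t. exact (continuous_comp c F t (Hc t) (HF t)). Qed.

Section Homotopy.
Variables (rho r : R) (F F' : C -> C) (z : C).
Hypothesis HF : holC1 rho F F'.
Hypothesis Hr : (0 < r < rho)%R.
Hypothesis Hz : (Cmod z < r)%R.

Let p (s t : R) : C := z + RtoC s * (circ r t - z).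

(** The margin on both sides of [0, 1] is needed because differentiation under the
    integral sign asks for a neighbourhood of each parameter. *)
Lemma homotopy_in s t : (- ((rho - r) / (2 * r)) < s < 1 + (rho - r) / (2 * r))%R ->
  (Cmod (p s t) < rho)%R.
Proof.
  intros Hs. unfold p.
  assert (E : Cmod (circ r t) = r) by (apply Cmod_circ; lra).
  pose proof (Cmod_ge_0 z).
  replace (z + RtoC s * (circ r t - z)) with (RtoC (1 - s) * z + RtoC s * circ r t)
    by (rewrite RtoC_minus; ring).
  eapply Rle_lt_trans; [apply Cmod_triangle|]. rewrite !Cmod_mult, !Cmod_R, E.
  set (d := ((rho - r) / (2 * r))%R) in *.
  assert (D : (d * (2 * r) = rho - r)%R) by (unfold d; field; lra).
  assert (0 < d)%R by (unfold d; apply Rdiv_lt_0_compat; lra).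
  unfold Rabs; destruct (Rcase_abs (1 - s)), (Rcase_abs s); nra.
Qed.

Let d0 := ((rho - r) / (2 * r))%R.
Lemma homotopy_margin_pos : (0 < d0)%R.
Proof. unfold d0. apply Rdiv_lt_0_compat; lra. Qed.

Let K (t : R) : C := circ r t / (circ r t - z).

(** The circle avoids [z], so that the weight [K] below has no pole. *)
Lemma circ_neq t : circ r t - z <> 0.
Proof.
  intro E. apply (f_equal Cmod) in E. rewrite Cmod_0 in E.
  pose proof (Cmod_lower (circ r t) z).
  replace (z - circ r t) with (- (circ r t - z)) in H by ring.
  rewrite Cmod_opp, E, Cmod_circ in H; lra.
Qed.

Lemma K_cont : ccont K.
Proof.
  intro t. unfold K, Cdiv. apply (continuous_Cmult (T := R_UniformSpace)).
  - apply ccont_circ.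
  - apply (continuous_Cinv_comp (T := R_UniformSpace)); [|apply circ_neq].
    apply (continuous_Cplus (T := R_UniformSpace)); [apply ccont_circ|].
    apply (continuous_const (U := R_UniformSpace) (V := C_UniformSpace)).
Qed.

Lemma p_cont2 s t : @continuous (prod_UniformSpace R_UniformSpace R_UniformSpace)
  C_UniformSpace (fun q => p (fst q) (snd q)) (s, t).
Proof.
  unfold p.
  assert (A : forall a : C, @continuous (prod_UniformSpace R_UniformSpace R_UniformSpace)
     C_UniformSpace (fun _ => a) (s, t)) by (intro; apply continuous_const).
  assert (B : @continuous (prod_UniformSpace R_UniformSpace R_UniformSpace)
     C_UniformSpace (fun q => circ r (snd q)) (s, t)).
  { apply (continuous_comp (fun q : prod_UniformSpace R_UniformSpace R_UniformSpace => snd q)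
      (circ r : R_UniformSpace -> C_UniformSpace)). apply continuous_snd. apply ccont_circ. }
  apply continuous_Cplus; [apply A|]. apply continuous_Cmult.
  - apply continuous_C_pair; simpl. apply continuous_fst. apply continuous_const.
  - apply continuous_Cplus; [exact B|apply A].
Qed.

(** The weight [K] is chosen to cancel the factor [circ r t - z] that the chain rule
    produces. *)
Lemma homotopy_ds s t : (- d0 < s < 1 + d0)%R ->
  curve_derive (fun u => F (p u t) * K t) s (F' (p s t) * circ r t).
Proof.
  intros Hs. pose proof (homotopy_in s t Hs) as Hp.
  assert (X : curve_derive (fun u => p u t) s (circ r t - z)).
  { unfold p. split; unfold Re, Im, RtoC, Cplus, Cminus, Copp, Cmult; simpl;
    auto_derive; auto; ring. }
  pose proof (curve_derive_comp F _ s _ _ (proj1 (HF _ Hp)) X) as Y.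
  pose proof (curve_derive_affine 0 (K t) _ s _ Y) as Z.
  replace (F' (p s t) * circ r t) with (K t * (F' (p s t) * (circ r t - z))).
  2:{ unfold K. field. apply circ_neq. }
  revert Z. apply curve_derive_ext. intro u. ring.
Qed.

(** For [s > 0] the integrand is, up to the factor [s * Ci], the derivative in [t] of the
    periodic function [F (p s t)]. For [s = 0] it is a multiple of [circ r t], itself a
    derivative in the same way. *)
Lemma homotopy_integral_zero s : (0 <= s <= 1)%R ->
  cmean (fun t => F' (p s t) * circ r t) = 0.
Proof.
  intros Hs. pose proof homotopy_margin_pos.
  assert (Hp : forall t, (Cmod (p s t) < rho)%R)
    by (intro; apply homotopy_in; fold d0; lra).
  destruct (Req_dec s 0) as [E|N].
  - subst s. transitivity (cmean (fun t => F' z * circ r t)).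
    { apply cmean_ext. intro t. unfold p. do 2 f_equal. ring. }
    rewrite cmean_scal by apply ccont_circ.
    assert (Z : cmean (fun t => Ci * circ r t) = 0).
    { apply (cmean_derivative_closed_curve (circ r)). apply circ_derive.
      - apply ccont_mult. apply ccont_const. apply ccont_circ.
      - symmetry. apply circ_period. }
    rewrite cmean_scal in Z by apply ccont_circ.
    replace (cmean (circ r)) with (- Ci * (Ci * cmean (circ r))).
    2:{ replace (- Ci * (Ci * cmean (circ r))) with (- (Ci * Ci) * cmean (circ r)) by ring.
        replace (Ci * Ci) with (- RtoC 1). ring.
        unfold Ci, Cmult, RtoC, Copp; simpl; f_equal; ring. }
    rewrite Z. ring.
  - assert (Ns : RtoC s <> 0) by (intro X; apply N; now apply RtoC_inj).
    assert (Pc : ccont (p s)).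
    { unfold p. apply ccont_plus. apply ccont_const. apply ccont_mult. apply ccont_const.
      apply ccont_plus. apply ccont_circ. apply ccont_const. }
    assert (C1 : ccont (fun t => F' (p s t) * circ r t)).
    { apply ccont_mult; [|apply ccont_circ]. apply ccont_comp; auto.
      intro t. apply HF, Hp. }
    assert (Z : cmean (fun t => (RtoC s * Ci) * (F' (p s t) * circ r t)) = 0).
    { apply (cmean_derivative_closed_curve (fun t => F (p s t))).
      - intro t.
        replace (RtoC s * Ci * (F' (p s t) * circ r t)) with
          (F' (p s t) * (RtoC s * (Ci * circ r t))) by ring.
        apply curve_derive_comp. apply HF, Hp.
        pose proof (curve_derive_affine (z - RtoC s * z) (RtoC s) _ t _ (circ_derive r t)) as Z.
        revert Z. apply curve_derive_ext. intro u. unfold p. ring.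
      - apply ccont_mult; [apply ccont_const|exact C1].
      - unfold p. now rewrite circ_period. }
    rewrite cmean_scal in Z by assumption.
    destruct (Ceq_dec (cmean (fun t => F' (p s t) * circ r t)) 0) as [E|E]; [exact E|].
    exfalso. refine (Cmult_neq_0 _ _ (Cmult_neq_0 _ _ Ns Ci_nz) E Z).
Qed.

(** Differentiation under the integral sign, one real-linear coordinate [P] of the
    integrand at a time: [Re] and then [Im]. *)
Lemma homotopy_param (P : C -> R) :
  (forall c s g, curve_derive c s g -> is_derive (fun u => P (c u)) s (P g)) ->
  (forall (T : UniformSpace) (f : T -> C) x, @continuous T C_UniformSpace f x ->
     continuous (fun t => P (f t)) x) ->
  (forall s, (0 <= s <= 1)%R -> rmean (fun t => P (F' (p s t) * circ r t)) = 0%R) ->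
  RInt (fun t => P (F (p 0 t) * K t)) 0 (2 * PI) = RInt (fun t => P (F (p 1 t) * K t)) 0 (2 * PI).
Proof.
  intros Pd Pc Pz. pose proof homotopy_margin_pos as D0.
  assert (LocIn : forall s, (0 <= s <= 1)%R -> locally s (fun u => - d0 < u < 1 + d0)%R).
  { intros s Hs. exists (mkposreal d0 D0). intros u Hu.
    apply Rabs_def2 in Hu. unfold minus, plus, opp in Hu; simpl in Hu. lra. }
  assert (PcF : forall s, (- d0 < s < 1 + d0)%R -> rcont (fun t => P (F (p s t) * K t))).
  { intros s Hs t. apply (Pc R_UniformSpace).
    apply (ccont_mult (fun t => F (p s t)) K); [|apply K_cont].
    apply ccont_comp.
    - unfold p. apply ccont_plus. apply ccont_const. apply ccont_mult. apply ccont_const.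
      apply ccont_plus. apply ccont_circ. apply ccont_const.
    - intro t'. apply (holC1_continuous rho F F'); auto. now apply homotopy_in. }
  apply (eq_is_derive (V := R_NormedModule)
    (fun s => RInt (fun t => P (F (p s t) * K t)) 0 (2 * PI))); [|lra].
  intros s Hs.
  assert (HD : forall u t, (- d0 < u < 1 + d0)%R ->
    is_derive (fun s => P (F (p s t) * K t)) u (P (F' (p u t) * circ r t))).
  { intros u t Hu. apply (Pd (fun s => F (p s t) * K t)). now apply homotopy_ds. }
  assert (E : RInt (fun t => Derive (fun u => P (F (p u t) * K t)) s) 0 (2 * PI) = 0%R).
  { specialize (Pz s Hs). unfold rmean in Pz. 
    rewrite (RInt_ext _ (fun t => P (F' (p s t) * circ r t))).
    - pose proof two_PI_pos as H2. apply (Rmult_eq_reg_r (/ (2 * PI))%R).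
      + unfold Rdiv in Pz. rewrite Pz. ring.
      + apply Rgt_not_eq. now apply Rinv_0_lt_compat.
    - intros t _. apply is_derive_unique, HD. lra. }
  assert (Z : is_derive (fun s => RInt (fun t => P (F (p s t) * K t)) 0 (2 * PI)) s
     (RInt (fun t => Derive (fun u => P (F (p u t) * K t)) s) 0 (2 * PI))).
  { apply (is_derive_RInt_param (fun s t => P (F (p s t) * K t))).
    - eapply filter_imp; [|apply (LocIn s Hs)]. intros u Hu t _. eexists. now apply HD.
    - intros t _.
      apply (continuity_2d_pt_ext_loc (fun u v => P (F' (p u v) * circ r v))).
      + exists (mkposreal d0 D0). intros u v Hu _. symmetry. apply is_derive_unique, HD.
        simpl in Hu. apply Rabs_def2 in Hu. lra.
      + apply continuity_2d_pt_filterlim.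
        apply (Pc (prod_UniformSpace R_UniformSpace R_UniformSpace)
          (fun q => F' (p (fst q) (snd q)) * circ r (snd q)) (s, t)).
        apply continuous_Cmult.
        * apply (continuous_comp (fun q : prod_UniformSpace R_UniformSpace R_UniformSpace
             => p (fst q) (snd q) : C_UniformSpace) F').
          apply p_cont2. apply HF. apply homotopy_in. fold d0. simpl. lra.
        * apply (continuous_comp (fun q : prod_UniformSpace R_UniformSpace R_UniformSpace => snd q)
            (circ r : R_UniformSpace -> C_UniformSpace)). apply continuous_snd. apply ccont_circ.
    - eapply filter_imp; [|apply (LocIn s Hs)]. intros u Hu.
      apply rcont_ex_RInt. now apply PcF. }
  rewrite E in Z. exact Z.
Qed.

(** The contraction [p s t = z + s (circ r t - z)] joins the constant [z] to the circle,
    and the weighted mean of [F] along it has derivative zero in [s]. *)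
Lemma cauchy_homotopy :
  cmean (fun t => F (circ r t) * (circ r t / (circ r t - z)))
  = F z * cmean (fun t => circ r t / (circ r t - z)).
Proof.
  pose proof homotopy_margin_pos.
  fold K. rewrite <- cmean_scal by apply K_cont.
  assert (E : cmean (fun t => F (p 1 t) * K t) = cmean (fun t => F (p 0 t) * K t)).
  { assert (Z : forall s, (0 <= s <= 1)%R -> cmean (fun t => F' (p s t) * circ r t) = 0)
      by apply homotopy_integral_zero.
    unfold cmean, rmean. f_equal; f_equal; symmetry.
    - apply (homotopy_param Re).
      + intros c s g [H1 _]; exact H1.
      + intros T f x. apply continuous_Re_comp.
      + intros s Hs. exact (f_equal Re (Z s Hs)).
    - apply (homotopy_param Im).
      + intros c s g [_ H1]; exact H1.
      + intros T f x. apply continuous_Im_comp.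
      + intros s Hs. exact (f_equal Im (Z s Hs)). }
  rewrite (cmean_ext _ (fun t => F (p 1 t) * K t)).
  - rewrite E. apply cmean_ext. intro t. do 2 f_equal. unfold p. ring.
  - intro t. unfold K. do 2 f_equal. unfold p. ring.
Qed.
End Homotopy.

(** The case [z = 0] of the contraction, where the weight is identically [1]. *)
Lemma mean_value rho r F F' : holC1 rho F F' -> (0 < r < rho)%R ->
  cmean (fun t => F (circ r t)) = F 0.
Proof.
  intros HF Hr.
  assert (Nz : forall t, circ r t <> 0).
  { intros t E. apply (f_equal Cmod) in E. rewrite Cmod_circ, Cmod_0 in E; lra. }
  assert (E : forall t, circ r t / (circ r t - 0) = 1).
  { intro t. replace (circ r t - 0) with (circ r t) by ring. field. apply Nz. }
  pose proof (cauchy_homotopy rho r F F' 0 HF Hr) as H.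
  rewrite (cmean_ext (fun t => circ r t / (circ r t - 0)) _ E), cmean_const in H.
  rewrite <- (Cmult_1_r (F 0)), <- H by (rewrite Cmod_0; lra).
  apply cmean_ext. intro t. rewrite E. ring.
Qed.

(** * Complex power series on the unit disk *)

Definition Cseries (c : nat -> C) (l : C) : Prop :=
  is_series (fun k => Re (c k)) (Re l) /\ is_series (fun k => Im (c k)) (Im l).

Lemma Cseries_ext c d l : (forall k, c k = d k) -> Cseries c l -> Cseries d l.
Proof.
  intros E [H1 H2]; split.
  - apply (is_series_ext (fun k => Re (c k))); auto. intro; now rewrite E.
  - apply (is_series_ext (fun k => Im (c k))); auto. intro; now rewrite E.
Qed.

Lemma Cseries_plus c d l m : Cseries c l -> Cseries d m ->
  Cseries (fun k => c k + d k) (l + m).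
Proof.
  intros [H1 H2] [H3 H4]; split.
  - exact (is_series_plus _ _ _ _ H1 H3).
  - exact (is_series_plus _ _ _ _ H2 H4).
Qed.

Lemma Cseries_scal a c l : Cseries c l -> Cseries (fun k => a * c k) (a * l).
Proof.
  intros [H1 H2].
  pose proof (fun x => is_series_scal (K := R_AbsRing) (V := R_NormedModule) x _ _ H1) as S1.
  pose proof (fun x => is_series_scal (K := R_AbsRing) (V := R_NormedModule) x _ _ H2) as S2.
  split.
  - pose proof (is_series_minus _ _ _ _ (S1 (Re a)) (S2 (Im a))) as X.
    eapply is_series_ext; [|exact X]. intro k. reflexivity.
  - pose proof (is_series_plus _ _ _ _ (S2 (Re a)) (S1 (Im a))) as X.
    eapply is_series_ext; [|exact X]. intro k. reflexivity.
Qed.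

Lemma Cseries_unique c l m : Cseries c l -> Cseries c m -> l = m.
Proof.
  intros [H1 H2] [H3 H4].
  apply is_series_unique in H1. apply is_series_unique in H2.
  apply is_series_unique in H3. apply is_series_unique in H4.
  destruct l, m. simpl in *. congruence.
Qed.

Lemma Cseries_shift1 c l : Cseries (fun k => c (S k)) l -> Cseries c (c 0%nat + l).
Proof.
  intros [H1 H2]; split; apply is_series_decr_1.
  - eapply eq_ind_r with (P := is_series _); [exact H1|].
    unfold plus, opp; simpl. unfold Re. simpl. ring.
  - eapply eq_ind_r with (P := is_series _); [exact H2|].
    unfold plus, opp; simpl. unfold Im. simpl. ring.
Qed.

Lemma sum_n_le (f g : nat -> R) N : (forall k, f k <= g k)%R ->
  (sum_n f N <= sum_n g N)%R.
Proof. intros H. rewrite !sum_n_Reals. apply sum_Rle. auto. Qed.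

(** The triangle inequality for infinite sums; multiplying by the conjugate of the sum
    reduces it to real limits. *)
Lemma Cseries_bound c l B : Cseries c l ->
  (forall N, sum_n (fun k => Cmod (c k)) N <= B)%R -> (Cmod l <= B)%R.
Proof.
  intros H HB.
  destruct (Rle_lt_or_eq_dec 0 (Cmod l) (Cmod_ge_0 l)) as [P|E].
  2:{ rewrite <- E. specialize (HB 0%nat). rewrite sum_O in HB.
      pose proof (Cmod_ge_0 (c 0%nat)). lra. }
  apply (Rmult_le_reg_l (Cmod l)); [exact P|].
  pose proof (Cseries_scal (Cconj l) c l H) as [X _].
  assert (E : Re (Cconj l * l) = (Cmod l * Cmod l)%R).
  { replace (Cconj l * l) with (l * Cconj l) by ring. rewrite <- Cmod2_conj. simpl. ring. }
  rewrite E in X. clear E.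
  refine (is_lim_seq_le (sum_n (fun k => Re (Cconj l * c k))) _ (Cmod l * Cmod l)%R
    (Cmod l * B)%R _ X (is_lim_seq_const (Cmod l * B))).
  intro N. apply Rle_trans with (sum_n (fun k => Cmod l * Cmod (c k))%R N).
  - apply sum_n_le. intro k. eapply Rle_trans; [apply Rle_abs|].
    eapply Rle_trans; [apply re_le_Cmod|]. rewrite Cmod_mult, Cmod_conj. lra.
  - change (sum_n (fun k => scal (Cmod l) (Cmod (c k))) N <= Cmod l * B)%R.
    rewrite (sum_n_scal_l (Cmod l) (fun k => Cmod (c k)) N).
    apply Rmult_le_compat_l; [lra|apply HB].
Qed.

Definition Csum (c : nat -> C) : C := (Series (fun k => Re (c k)), Series (fun k => Im (c k))).

Lemma Cseries_abs c : ex_series (fun k => Cmod (c k)) -> Cseries c (Csum c).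
Proof.
  intros H. split; simpl; apply Series_correct.
  - apply (ex_series_le (V := R_CompleteNormedModule) _ (fun k => Cmod (c k))); auto.
    intro k. apply re_le_Cmod.
  - apply (ex_series_le (V := R_CompleteNormedModule) _ (fun k => Cmod (c k))); auto.
    intro k. apply im_le_Cmod.
Qed.

(** Another way to say that the radius of convergence is at least [1]. Boundedness of the
    terms, unlike convergence of the series, passes at once to [k a_k], to shifts and to
    truncations. *)
Definition converges (a : nat -> C) : Prop :=
  forall r, (0 <= r < 1)%R -> exists M, forall k, (Cmod (a k) * r ^ k <= M)%R.

Definition power_sum (a : nat -> C) (z : C) : C := Csum (fun k => a k * z ^ k).

Lemma converges_abs a z : converges a -> (Cmod z < 1)%R ->
  ex_series (fun k => Cmod (a k * z ^ k)).
Proof.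
  intros Ha Hz. pose proof (Cmod_ge_0 z).
  set (r := ((1 + Cmod z) / 2)%R).
  assert (Hr : (0 <= r < 1)%R) by (unfold r; lra).
  assert (Hr0 : (0 < r)%R) by (unfold r; lra).
  destruct (Ha r Hr) as [M HM].
  apply (ex_series_le (V := R_CompleteNormedModule) _ (fun k => M * (Cmod z / r) ^ k)%R).
  - intro k. unfold norm; simpl. unfold abs; simpl.
    rewrite Rabs_pos_eq by apply Cmod_ge_0. rewrite Cmod_mult, Cmod_pow.
    unfold Rdiv. rewrite Rpow_mult_distr.
    replace (Cmod (a k) * Cmod z ^ k)%R
      with ((Cmod (a k) * r ^ k) * (Cmod z ^ k * (/ r) ^ k))%R.
    + apply Rmult_le_compat_r; [|apply HM].
      apply Rmult_le_pos; apply pow_le; auto. left. now apply Rinv_0_lt_compat.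
    + rewrite pow_inv. field. apply pow_nonzero. lra.
  - apply (ex_series_scal_l (K := R_AbsRing) (V := R_NormedModule) M (fun k => (Cmod z / r) ^ k)%R).
    apply ex_series_geom. rewrite Rabs_pos_eq.
    + apply Rlt_div_l; [lra|]. unfold r. lra.
    + apply Rdiv_le_0_compat; lra.
Qed.

Lemma power_sum_correct a z : converges a -> (Cmod z < 1)%R -> Cseries (fun k => a k * z ^ k) (power_sum a z).
Proof. intros Ha Hz. apply Cseries_abs. now apply converges_abs. Qed.

Lemma power_sum_unique a z l : converges a -> (Cmod z < 1)%R -> Cseries (fun k => a k * z ^ k) l -> power_sum a z = l.
Proof. intros Ha Hz H. eapply Cseries_unique; [now apply power_sum_correct|exact H]. Qed.

(** The factor [k] is absorbed by passing to a larger radius [s < 1], since [k x <= (1 +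
    x)^k] for [1 + x = s / r]. *)
Lemma converges_mulk a : converges a -> converges (fun k => RtoC (INR k) * a k).
Proof.
  intros Ha r Hr. set (s := ((1 + r) / 2)%R).
  assert (Hs : (0 < s < 1)%R) by (unfold s; lra).
  destruct (Ha s ltac:(lra)) as [M HM].
  destruct (Rle_lt_or_eq_dec 0 r (proj1 Hr)) as [P|E].
  - set (x := (s / r - 1)%R).
    assert (Hx : (0 < x)%R).
    { unfold x. assert (1 < s / r)%R; [|lra]. apply Rlt_div_r; unfold s; lra. }
    exists (M * / x)%R. intro k. rewrite Cmod_mult, Cmod_R, Rabs_pos_eq by apply pos_INR.
    assert (Q : (INR k * x <= (s / r) ^ k)%R).
    { pose proof (poly k x Hx). unfold x in H at 2. replace (1 + (s / r - 1))%R with (s/r)%R in H by ring. lra. }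
    apply Rle_div_r in Q; [|lra].
    pose proof (pow_lt r k P).
    apply Rle_trans with ((s / r) ^ k / x * Cmod (a k) * r ^ k)%R.
    + apply Rmult_le_compat_r; [lra|]. apply Rmult_le_compat_r; [apply Cmod_ge_0|exact Q].
    + replace ((s / r) ^ k / x * Cmod (a k) * r ^ k)%R with ((Cmod (a k) * s ^ k) * / x)%R.
      * apply Rmult_le_compat_r; [left; now apply Rinv_0_lt_compat|apply HM].
      * unfold Rdiv. rewrite Rpow_mult_distr, pow_inv. field. split; lra.
  - exists 0%R. intro k. subst r. destruct k.
    + simpl. rewrite Cmod_mult, Cmod_R, Rabs_R0. lra.
    + rewrite pow_i by lia. lra.
Qed.

Lemma converges_shift a : converges a -> converges (fun k => a (S k)).
Proof.
  intros Ha r Hr. destruct (Rle_lt_or_eq_dec 0 r (proj1 Hr)) as [P|E].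
  - destruct (Ha r Hr) as [M HM]. exists (M / r)%R. intro k.
    apply (proj1 (Rle_div_r (Cmod (a (S k)) * r ^ k) M r P)).
    specialize (HM (S k)). simpl in HM. lra.
  - exists (Cmod (a 1%nat)). intro k. subst r. destruct k.
    + simpl. lra.
    + rewrite pow_i by lia. rewrite Rmult_0_r. apply Cmod_ge_0.
Qed.

(** The coefficients of the termwise derivative. *)
Definition derived (a : nat -> C) (k : nat) : C := RtoC (INR (S k)) * a (S k).

Lemma converges_derived a : converges a -> converges (derived a).
Proof. intros Ha. exact (converges_shift _ (converges_mulk a Ha)). Qed.

Lemma power_sum_step a z : converges a -> (Cmod z < 1)%R ->
  power_sum a z = a 0%nat + z * power_sum (fun k => a (S k)) z.
Proof.
  intros Ha Hz. apply power_sum_unique; auto.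
  replace (a 0%nat) with (a 0%nat * z ^ 0) at 1 by (simpl; ring).
  apply (Cseries_shift1 (fun k => a k * z ^ k)).
  eapply Cseries_ext; [|apply Cseries_scal, power_sum_correct; [apply converges_shift|]; auto].
  intro k. simpl. ring.
Qed.

Lemma power_sum_0 a : converges a -> power_sum a 0 = a 0%nat.
Proof. intros Ha. rewrite power_sum_step; auto. ring. rewrite Cmod_0; lra. Qed.

(** The bound is [k^2 rho^(k-2) |w - z|^2]; it is multiplied by [rho^2] because natural
    subtraction would spoil the exponent for [k < 2]. *)
Lemma pow_taylor2 (w z : C) (rho : R) k :
  (0 < rho)%R -> (Cmod w <= rho)%R -> (Cmod z <= rho)%R ->
  (Cmod (w ^ k - z ^ k - (w - z) * (RtoC (INR k) * z ^ (pred k))) * (rho * rho)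
    <= INR k * INR k * rho ^ k * (Cmod (w - z) * Cmod (w - z)))%R.
Proof.
  intros Hr Hw Hz. set (d := Cmod (w - z)).
  induction k.
  - simpl. replace (1 - 1 - (w - z) * (0 * 1)) with (RtoC 0) by ring. rewrite Cmod_0. lra.
  - set (e := w ^ k - z ^ k - (w - z) * (RtoC (INR k) * z ^ (pred k))) in *.
    assert (E : w ^ S k - z ^ S k - (w - z) * (RtoC (INR (S k)) * z ^ pred (S k))
      = w * e + RtoC (INR k) * z ^ (pred k) * ((w - z) * (w - z))).
    { unfold e. rewrite S_INR, RtoC_plus. destruct k; simpl; ring. }
    rewrite E. clear E.
    apply Rle_trans with ((rho * Cmod e + INR k * rho ^ (pred k) * (d * d)) * (rho * rho))%R.
    + apply Rmult_le_compat_r; [nra|]. eapply Rle_trans; [apply Cmod_triangle|].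
      rewrite !Cmod_mult, Cmod_R, Cmod_pow, Rabs_pos_eq by apply pos_INR. fold d.
      apply Rplus_le_compat.
      * apply Rmult_le_compat_r; [apply Cmod_ge_0|auto].
      * apply Rmult_le_compat_r; [apply Rle_0_sqr|].
        apply Rmult_le_compat_l; [apply pos_INR|]. apply pow_incr. split; auto. apply Cmod_ge_0.
    + assert (P : (INR k * rho ^ pred k * (d * d) * (rho * rho) <= INR k * (rho ^ k * rho) * (d * d))%R).
      { destruct k; simpl; [lra|]. right. ring. }
      assert (0 <= d)%R by apply Cmod_ge_0. pose proof (pow_lt rho k Hr).
      pose proof (pos_INR k). rewrite S_INR. simpl.
      assert (rho * (Cmod e * (rho * rho)) <= rho * (INR k * INR k * rho ^ k * (d * d)))%R
        by (apply Rmult_le_compat_l; lra).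
      set (X := (rho * rho ^ k * (d * d))%R) in *.
      assert (0 <= X)%R by (unfold X; repeat apply Rmult_le_pos; lra).
      replace ((INR k + 1) * (INR k + 1) * (rho * rho ^ k) * (d * d))%R
        with ((INR k * INR k + 2 * INR k + 1) * X)%R by (unfold X; ring).
      assert (E1 : (rho * (INR k * INR k * rho ^ k * (d * d)) = INR k * INR k * X)%R) by (unfold X; ring).
      assert (E2 : (INR k * (rho ^ k * rho) * (d * d) = INR k * X)%R) by (unfold X; ring).
      nra.
Qed.

Lemma sum_n_le_Series (f : nat -> R) N : (forall k, 0 <= f k)%R -> ex_series f ->
  (sum_n f N <= Series f)%R.
Proof.
  intros Hp He. rewrite sum_n_Reals.
  apply (sum_incr f N (Series f)); [|exact Hp].
  apply is_lim_seq_Reals. apply Series_correct in He.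
  eapply is_lim_seq_ext; [|exact He]. intro; apply sum_n_Reals.
Qed.

(** Termwise use of [pow_taylor2]; the constant is the sum of [k^2 |a_k| rho^k] divided by
    [rho^2]. *)
Lemma power_sum_taylor2 a (rho : R) : converges a -> (0 < rho < 1)%R -> exists B, (0 <= B)%R /\
  forall w z, (Cmod w <= rho)%R -> (Cmod z <= rho)%R ->
  (Cmod (power_sum a w - power_sum a z - (w - z) * power_sum (derived a) z) <= B * (Cmod (w - z) * Cmod (w - z)))%R.
Proof.
  intros Ha Hr.
  pose proof (converges_mulk _ (converges_mulk _ Ha)) as H2.
  assert (Hm : (Cmod (RtoC rho) < 1)%R) by (rewrite Cmod_R, Rabs_pos_eq; lra).
  pose proof (converges_abs _ (RtoC rho) H2 Hm) as Hs.
  set (f := fun k => Cmod (RtoC (INR k) * (RtoC (INR k) * a k) * RtoC rho ^ k)) in *.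
  assert (Ef : forall k, f k = (Cmod (a k) * (INR k * INR k * rho ^ k))%R).
  { intro k. unfold f. rewrite !Cmod_mult, Cmod_pow, !Cmod_R.
    rewrite !Rabs_pos_eq by (apply pos_INR || lra). ring. }
  assert (F0 : forall k, (0 <= f k)%R) by (intro; apply Cmod_ge_0).
  exists (Series f / (rho * rho))%R. split.
  { apply Rdiv_le_0_compat; [|nra]. eapply Rle_trans; [|apply (sum_n_le_Series f 0); auto].
    rewrite sum_O. apply F0. }
  intros w z Hw Hz. set (d := Cmod (w - z)).
  assert (Hw1 : (Cmod w < 1)%R) by lra. assert (Hz1 : (Cmod z < 1)%R) by lra.
  pose proof (power_sum_correct a w Ha Hw1) as Sw. pose proof (power_sum_correct a z Ha Hz1) as Sz.
  pose proof (power_sum_correct _ z (converges_derived a Ha) Hz1) as Sd.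
  assert (Sd' : Cseries (fun k => RtoC (INR k) * a k * z ^ (pred k)) (power_sum (derived a) z)).
  { replace (power_sum (derived a) z) with ((RtoC (INR 0) * a 0%nat * z ^ (pred 0)) + power_sum (derived a) z) by (simpl; ring).
    apply (Cseries_shift1 (fun k => RtoC (INR k) * a k * z ^ (pred k))). exact Sd. }
  apply (Cseries_scal (- (w - z))) in Sd'. apply (Cseries_scal (- (1))) in Sz.
  pose proof (Cseries_plus _ _ _ _ (Cseries_plus _ _ _ _ Sw Sz) Sd') as St.
  replace (power_sum a w - power_sum a z - (w - z) * power_sum (derived a) z) with
    (power_sum a w + - (1) * power_sum a z + - (w - z) * power_sum (derived a) z) by ring.
  apply (Cseries_bound _ _ _ St).
  intro N. apply Rle_trans with (sum_n (fun k => (/ (rho * rho) * (d * d)) * f k)%R N).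
  - apply sum_n_le. intro k. rewrite Ef.
    replace (a k * w ^ k + - (1) * (a k * z ^ k) + - (w - z) * (RtoC (INR k) * a k * z ^ pred k))
      with (a k * (w ^ k - z ^ k - (w - z) * (RtoC (INR k) * z ^ (pred k)))) by ring.
    rewrite Cmod_mult.
    replace (/ (rho * rho) * (d * d) * (Cmod (a k) * (INR k * INR k * rho ^ k)))%R
      with (Cmod (a k) * ((INR k * INR k * rho ^ k * (d * d)) / (rho * rho)))%R by (field; lra).
    apply Rmult_le_compat_l; [apply Cmod_ge_0|].
    refine (proj1 (Rle_div_r _ _ (rho * rho) _) _); [nra|].
    apply pow_taylor2; lra.
  - change (sum_n (fun k => scal (/ (rho * rho) * (d * d))%R (f k)) N <= Series f / (rho * rho) * (d * d))%R.
    rewrite (sum_n_scal_l (/ (rho * rho) * (d * d))%R f N). unfold scal; simpl; unfold mult; simpl.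
    replace (Series f / (rho * rho) * (d * d))%R with (/ (rho * rho) * (d * d) * Series f)%R by (field; lra).
    apply Rmult_le_compat_l; [|now apply sum_n_le_Series].
    apply Rmult_le_pos; [left; apply Rinv_0_lt_compat; nra|apply Rle_0_sqr].
Qed.

Lemma power_sum_is_derive a z : converges a -> (Cmod z < 1)%R -> is_derive (power_sum a) z (power_sum (derived a) z).
Proof.
  intros Ha Hz. pose proof (Cmod_ge_0 z).
  set (rho := ((1 + Cmod z) / 2)%R).
  destruct (power_sum_taylor2 a rho Ha) as [B [HB HT]]; [unfold rho; lra|].
  apply is_derive_C_epsilon. intros e He.
  exists (Rmin (rho - Cmod z) (e / (B + 1))). split.
  { apply Rmin_case; [unfold rho; lra|]. apply Rdiv_lt_0_compat; lra. }
  intros w Hw.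
  pose proof (Rlt_le_trans _ _ _ Hw (Rmin_l _ _)) as H1.
  pose proof (Rlt_le_trans _ _ _ Hw (Rmin_r _ _)) as H2.
  apply Rlt_div_r in H2; [|lra].
  assert (Hw' : (Cmod w <= rho)%R).
  { replace w with ((w - z) + z) by ring. eapply Rle_trans; [apply Cmod_triangle|]. lra. }
  eapply Rle_trans; [apply HT; [exact Hw'|unfold rho; lra]|].
  pose proof (Cmod_ge_0 (w - z)). nra.
Qed.

Lemma power_sum_holC1 a : converges a -> holC1 1 (power_sum a) (power_sum (derived a)).
Proof.
  intros Ha z Hz. split; [now apply power_sum_is_derive|].
  eapply is_derive_C_continuous, power_sum_is_derive; auto. now apply converges_derived.
Qed.

Lemma Re_sum_n (c : nat -> C) N : Re (sum_n c N) = sum_n (fun k => Re (c k)) N.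
Proof.
  induction N; [now rewrite !sum_O|]. rewrite !sum_Sn, <- IHN. reflexivity.
Qed.
Lemma Im_sum_n (c : nat -> C) N : Im (sum_n c N) = sum_n (fun k => Im (c k)) N.
Proof.
  induction N; [now rewrite !sum_O|]. rewrite !sum_Sn, <- IHN. reflexivity.
Qed.

Lemma pow_n_Cpow (z : C) k : pow_n (K := C_AbsRing) z k = z ^ k.
Proof. induction k; [reflexivity|]. simpl. now rewrite IHk. Qed.

Lemma is_pseries_Cseries a z l : is_pseries a z l -> Cseries (fun k => a k * z ^ k) l.
Proof.
  intros H.
  assert (E : forall k, scal (pow_n (K := C_AbsRing) z k) (a k) = a k * z ^ k).
  { intro k. rewrite pow_n_Cpow. exact (Cmult_comm _ _). }
  apply (is_series_ext _ _ _ E) in H.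
  split; unfold is_series.
  - eapply filterlim_ext; [intro N; apply Re_sum_n|].
    eapply filterlim_comp; [exact H|].
    exact (continuous_Re_comp (T := C_UniformSpace) (fun c => c) l (continuous_id _)).
  - eapply filterlim_ext; [intro N; apply Im_sum_n|].
    eapply filterlim_comp; [exact H|].
    exact (continuous_Im_comp (T := C_UniformSpace) (fun c => c) l (continuous_id _)).
Qed.

Lemma is_series_bounded (u : nat -> R) l : is_series u l ->
  exists M, forall k, (Rabs (u k) <= M)%R.
Proof.
  intros H. assert (L : is_lim_seq u 0) by (apply ex_series_lim_0; now exists l).
  apply is_lim_seq_Reals in L.
  destruct (maj_by_pos u (exist _ _ L)) as [M [_ HM]]. now exists M.
Qed.

Lemma expansion_converges f a : power_series_expansion f a -> converges a.
Proof.
  intros H r Hr.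
  assert (Hm : (Cmod (RtoC r) < 1)%R) by (rewrite Cmod_R, Rabs_pos_eq; lra).
  destruct (is_pseries_Cseries _ _ _ (H _ Hm)) as [H1 H2].
  destruct (is_series_bounded _ _ H1) as [M1 HM1].
  destruct (is_series_bounded _ _ H2) as [M2 HM2].
  exists (M1 + M2)%R. intro k.
  replace (Cmod (a k) * r ^ k)%R with (Cmod (a k * RtoC r ^ k)).
  - eapply Rle_trans; [apply Cmod_le_Re_Im|]. apply Rplus_le_compat; auto.
  - rewrite Cmod_mult, Cmod_pow, Cmod_R, Rabs_pos_eq; lra.
Qed.

Lemma expansion_power_sum f a z : power_series_expansion f a -> (Cmod z < 1)%R -> f z = power_sum a z.
Proof.
  intros H Hz. symmetry. apply power_sum_unique; auto. now apply (expansion_converges f).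
  apply is_pseries_Cseries, H, Hz.
Qed.

Fixpoint poly_sum (a : nat -> C) (m : nat) (z : C) : C :=
  match m with O => 0 | S k => poly_sum a k z + a k * z ^ k end.

Lemma converges_shiftn a m : converges a -> converges (fun k => a (m + k)%nat).
Proof.
  intros Ha. induction m; [exact Ha|].
  apply converges_shift in IHm. revert IHm. unfold converges.
  intros H r Hr. destruct (H r Hr) as [M HM]. exists M. intro k.
  replace (S m + k)%nat with (m + S k)%nat by lia. apply HM.
Qed.

Lemma power_sum_ext a b z : (forall k, a k = b k) -> power_sum a z = power_sum b z.
Proof.
  intros H. unfold power_sum, Csum. f_equal; apply Series_ext; intro; now rewrite H.
Qed.

(** Isolates a Taylor polynomial with a remainder that is again a power series, hence
    holomorphic. *)
Lemma power_sum_split a m z : converges a -> (Cmod z < 1)%R ->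
  power_sum a z = poly_sum a m z + z ^ m * power_sum (fun k => a (m + k)%nat) z.
Proof.
  intros Ha Hz. induction m.
  - simpl. ring_simplify. now apply power_sum_ext.
  - rewrite IHm, power_sum_step; auto; [|now apply converges_shiftn].
    simpl. rewrite Nat.add_0_r.
    rewrite (power_sum_ext (fun k => a (m + S k)%nat) (fun k => a (S (m + k))))
      by (intro; f_equal; lia). ring.
Qed.

(** * Power series whose logarithmic derivative lies in a half-plane *)

(** Forgets the derivative, which matters only inside the contraction argument. *)
Definition holomorphic (rho : R) (F : C -> C) : Prop := exists F', holC1 rho F F'.

Lemma holomorphic_const rho c : holomorphic rho (fun _ => c).
Proof. eexists. apply holC1_const. Qed.
Lemma holomorphic_id rho : holomorphic rho (fun z => z).
Proof. eexists. apply holC1_id. Qed.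
Lemma holomorphic_plus rho F G : holomorphic rho F -> holomorphic rho G -> holomorphic rho (fun z => F z + G z).
Proof. intros [F' HF] [G' HG]. eexists. now apply holC1_plus; eauto. Qed.
Lemma holomorphic_mult rho F G : holomorphic rho F -> holomorphic rho G -> holomorphic rho (fun z => F z * G z).
Proof. intros [F' HF] [G' HG]. eexists. now apply holC1_mult; eauto. Qed.
Lemma holomorphic_inv rho F : holomorphic rho F -> (forall z, (Cmod z < rho)%R -> F z <> 0) ->
  holomorphic rho (fun z => / F z).
Proof. intros [F' HF] HN. eexists. now apply holC1_inv; eauto. Qed.
Lemma holomorphic_pow rho n : holomorphic rho (fun z => z ^ n).
Proof.
  induction n; simpl. apply holomorphic_const. apply holomorphic_mult; auto. apply holomorphic_id.
Qed.
Lemma holomorphic_poly rho a n : holomorphic rho (poly_sum a n).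
Proof.
  induction n; simpl. apply holomorphic_const.
  apply (holomorphic_plus rho (poly_sum a n)); auto.
  apply holomorphic_mult. apply holomorphic_const. apply holomorphic_pow.
Qed.
Lemma holomorphic_power_sum a : converges a -> holomorphic 1 (power_sum a).
Proof. intros H. eexists. now apply power_sum_holC1. Qed.
Lemma holomorphic_ccont rho F r : holomorphic rho F -> (0 <= r < rho)%R -> ccont (fun t => F (circ r t)).
Proof.
  intros [F' HF] Hr. apply ccont_comp. apply ccont_circ.
  intro t. eapply holC1_continuous; eauto. rewrite Cmod_circ; lra.
Qed.
Lemma ccont_pow c n : ccont c -> ccont (fun t => c t ^ n).
Proof.
  intros H. induction n; simpl. apply ccont_const. now apply ccont_mult.
Qed.

Lemma holomorphic_mean rho r F : holomorphic rho F -> (0 < r < rho)%R -> cmean (fun t => F (circ r t)) = F 0.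
Proof. intros [F' HF]. now apply mean_value with (F' := F'). Qed.

Lemma Re_cmean c : Re (cmean c) = rmean (fun t => Re (c t)).
Proof. reflexivity. Qed.

Lemma Re_RtoC x : Re (RtoC x) = x.
Proof. reflexivity. Qed.

Lemma poly_S a n z : poly_sum a (S n) z = poly_sum a n z + a n * z ^ n.
Proof. reflexivity. Qed.

Section Circle.
Variables (rho r : R).
Hypothesis Hr : (0 < r < rho)%R.
Let z t := circ r t.

Lemma circ_conj_pow t k : z t ^ k * Cconj (z t ^ k) = RtoC ((r * r) ^ k).
Proof.
  rewrite <- Cmod2_conj, Cmod_pow. unfold z. rewrite Cmod_circ by lra.
  f_equal. rewrite <- pow_mult, Nat.mul_comm, pow_mult. f_equal. ring.
Qed.

(** On the circle [Cconj z] is [r^2 / z], so the integrand is a constant times [z^(m-k)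
    F], which vanishes at the centre. *)
Lemma mean_monomial_lt F m k : holomorphic rho F -> (k < m)%nat ->
  cmean (fun t => z t ^ m * F (z t) * Cconj (z t ^ k)) = 0.
Proof.
  intros HF Hk. destruct (Nat.le_exists_sub (S k) m Hk) as [i [Hi _]].
  assert (HG : holomorphic rho (fun w => w ^ S i * F w)) by (apply holomorphic_mult; auto; apply holomorphic_pow).
  rewrite (cmean_ext _ (fun t => RtoC ((r * r) ^ k) * (z t ^ S i * F (z t)))).
  - rewrite cmean_scal; [|exact (holomorphic_ccont _ _ r HG ltac:(lra))].
    unfold z. rewrite (holomorphic_mean rho r _ HG Hr). simpl. ring.
  - intro t. rewrite <- (circ_conj_pow t k).
    replace m with (S i + k)%nat by lia. rewrite Cpow_add_r. ring.
Qed.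

Lemma ccont_circ_pow k : ccont (fun t => z t ^ k).
Proof. apply ccont_pow, ccont_circ. Qed.

Lemma mean_monomial_gt m k : (k < m)%nat ->
  cmean (fun t => z t ^ k * Cconj (z t ^ m)) = 0.
Proof.
  intros H.
  rewrite (cmean_ext _ (fun t => Cconj (z t ^ m * 1 * Cconj (z t ^ k)))).
  - rewrite cmean_conj.
    + rewrite (mean_monomial_lt (fun _ => 1) m k (holomorphic_const _ _) H).
      unfold Cconj, RtoC; simpl. f_equal; ring.
    + apply ccont_mult. apply ccont_mult. apply ccont_circ_pow. apply ccont_const.
      apply ccont_conj, ccont_circ_pow.
  - intro t. rewrite !Cmult_conj, Cconj_conj.
    replace (Cconj 1) with (RtoC 1) by (unfold Cconj, RtoC; simpl; f_equal; ring). ring.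
Qed.

Lemma ccont_poly a m : ccont (fun t => poly_sum a m (z t)).
Proof. apply (holomorphic_ccont rho); [apply holomorphic_poly|lra]. Qed.

Lemma mean_poly e m k :
  cmean (fun t => poly_sum e m (z t) * Cconj (z t ^ k)) =
  if le_lt_dec m k then 0 else e k * RtoC ((r * r) ^ k).
Proof.
  induction m.
  - destruct (le_lt_dec 0 k); [|lia]. simpl.
    rewrite (cmean_ext _ (fun _ => 0)) by (intro; ring). apply cmean_const.
  - cbn [poly_sum].
    assert (C1 : ccont (fun t => Cconj (z t ^ k))) by apply ccont_conj, ccont_circ_pow.
    assert (C2 : ccont (fun t => z t ^ m * Cconj (z t ^ k))) by (apply ccont_mult; auto; apply ccont_circ_pow).
    rewrite (cmean_ext _ (fun t => poly_sum e m (z t) * Cconj (z t ^ k) + e m * (z t ^ m * Cconj (z t ^ k))))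
      by (intro; ring).
    rewrite cmean_plus, IHm, cmean_scal; auto.
    2:{ apply ccont_mult; auto. apply ccont_poly. }
    2:{ apply ccont_mult; auto. apply ccont_const. }
    destruct (lt_eq_lt_dec m k) as [[L|E]|G].
    + rewrite mean_monomial_gt by auto.
      destruct (le_lt_dec m k), (le_lt_dec (S m) k); try lia. ring.
    + subst k. rewrite (cmean_ext _ (fun _ => RtoC ((r * r) ^ m))) by (intro; apply circ_conj_pow).
      rewrite cmean_const.
      destruct (le_lt_dec m m), (le_lt_dec (S m) m); try lia. ring.
    + rewrite (cmean_ext _ (fun t => z t ^ m * 1 * Cconj (z t ^ k))) by (intro; ring).
      rewrite (mean_monomial_lt (fun _ => 1)) by (auto; apply holomorphic_const).
      destruct (le_lt_dec m k), (le_lt_dec (S m) k); try lia. ring.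
Qed.

(** Only the Taylor coefficients of order below [m] of [G] are seen by a polynomial of
    degree below [m]: the remainder is orthogonal to it, and so are distinct monomials to
    each other. *)
Lemma mean_pairing G E e d m : holomorphic rho E ->
  (forall w, (Cmod w < rho)%R -> G w = poly_sum e m w + w ^ m * E w) ->
  cmean (fun t => G (z t) * Cconj (poly_sum d m (z t)))
  = poly_sum (fun k => e k * Cconj (d k)) m (RtoC (r * r)).
Proof.
  intros HE HG.
  assert (HGz : forall t, G (z t) = poly_sum e m (z t) + z t ^ m * E (z t))
    by (intro t; apply HG; unfold z; rewrite Cmod_circ; lra).
  assert (CE : ccont (fun t => z t ^ m * E (z t))).
  { apply ccont_mult. apply ccont_circ_pow. apply (holomorphic_ccont rho); auto. lra. }
  assert (CG : ccont (fun t => G (z t))).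
  { intro t. eapply continuous_ext; [intro; symmetry; apply HGz|].
    apply (ccont_plus _ _ (ccont_poly e m) CE). }
  assert (Gk : forall k, (k < m)%nat ->
     cmean (fun t => G (z t) * Cconj (z t ^ k)) = e k * RtoC ((r * r) ^ k)).
  { intros k Hk.
    rewrite (cmean_ext _ (fun t => poly_sum e m (z t) * Cconj (z t ^ k)
       + z t ^ m * E (z t) * Cconj (z t ^ k))) by (intro; rewrite HGz; ring).
    assert (C1 : ccont (fun t => Cconj (z t ^ k))) by apply ccont_conj, ccont_circ_pow.
    rewrite cmean_plus, mean_poly, mean_monomial_lt; auto.
    - destruct (le_lt_dec m k); [lia|]. ring.
    - apply ccont_mult; auto. apply ccont_poly.
    - apply (ccont_mult (fun t => z t ^ m * E (z t))); auto. }
  assert (X : forall n, (n <= m)%nat -> cmean (fun t => G (z t) * Cconj (poly_sum d n (z t)))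
  = poly_sum (fun k => e k * Cconj (d k)) n (RtoC (r * r))); [|now apply X].
  induction n; intros Hn.
  - simpl. rewrite (cmean_ext _ (fun _ => 0)), cmean_const; auto.
    intro. replace (Cconj 0) with (RtoC 0) by (unfold Cconj, RtoC; simpl; f_equal; ring). ring.
  - simpl. rewrite (cmean_ext _ (fun t => G (z t) * Cconj (poly_sum d n (z t))
       + Cconj (d n) * (G (z t) * Cconj (z t ^ n))))
      by (intro; rewrite Cplus_conj, Cmult_conj; ring).
    assert (C2 : ccont (fun t => G (z t) * Cconj (z t ^ n)))
      by (apply ccont_mult; auto; apply ccont_conj, ccont_circ_pow).
    assert (C3 : ccont (fun t => G (z t) * Cconj (poly_sum d n (z t))))
      by (apply ccont_mult; auto; apply ccont_conj, ccont_poly).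
    rewrite (cmean_plus _ _ C3 (ccont_mult _ _ (ccont_const (Cconj (d n))) C2)),
      (cmean_scal _ _ C2), IHn, Gk by lia.
    rewrite <- RtoC_pow. ring.
Qed.

(** The way a bound on [Re phi] is used: [A - Re phi] is nonnegative, hence so is its mean
    against [|H|^2]. *)
Lemma halfplane_pairing (phi H : R -> C) A : ccont phi -> ccont H ->
  (forall t, Re (phi t) <= A)%R ->
  (Re (cmean (fun t => phi t * H t * Cconj (H t))%C)
   <= A * Re (cmean (fun t => H t * Cconj (H t))%C))%R.
Proof.
  intros C1 C2 HA.
  assert (C3 : ccont (fun t => H t * Cconj (H t))) by (apply ccont_mult; auto; now apply ccont_conj).
  assert (C4 : ccont (fun t => phi t * H t * Cconj (H t)))
    by (apply ccont_mult; [now apply ccont_mult|now apply ccont_conj]).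
  pose proof (ccont_Re _ C3) as C5. pose proof (ccont_Re _ C4) as C6.
  rewrite !Re_cmean, <- rmean_scal by exact C5.
  apply rmean_le; [exact C6|now apply rcont_scal|].
  intro t.
    replace (phi t * H t * Cconj (H t)) with (phi t * (H t * Cconj (H t))) by ring.
    rewrite <- Cmod2_conj, re_scal_r.
    change (Re (RtoC (Cmod (H t) ^ 2))) with (Cmod (H t) ^ 2)%R.
    apply Rmult_le_compat_r; [apply pow2_ge_0|apply HA].
Qed.
End Circle.

(** Lets the radius of the circle tend to [1]. *)
Lemma le_of_pow_limit (x y : R) n : (0 <= x)%R ->
  (forall r, (0 < r < 1)%R -> (x * (r * r) ^ n <= y)%R) -> (x <= y)%R.
Proof.
  intros Hx H.
  assert (L : is_lim_seq (fun k => x * ((1 - / INR (S (S k))) * (1 - / INR (S (S k)))) ^ n)%R (x * ((1 - 0) * (1 - 0)) ^ n)%R).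
  { assert (I : is_lim_seq (fun k => / INR (S (S k)))%R 0%R).
    { apply (is_lim_seq_incr_1 (fun k => / INR (S k))%R).
      apply (is_lim_seq_incr_1 (fun k => / INR k)%R).
      apply (is_lim_seq_inv INR p_infty is_lim_seq_INR). discriminate. }
    assert (J : is_lim_seq (fun k => 1 - / INR (S (S k)))%R (1 - 0)%R)
      by (apply is_lim_seq_minus'; auto; apply is_lim_seq_const).
    apply is_lim_seq_mult'; [apply is_lim_seq_const|].
    assert (K : is_lim_seq (fun k => (1 - / INR (S (S k))) * (1 - / INR (S (S k))))%R ((1 - 0) * (1-0))%R)
      by (now apply is_lim_seq_mult').
    clear H. induction n; simpl; [apply is_lim_seq_const|]. now apply is_lim_seq_mult'. }
  replace (x * ((1 - 0) * (1 - 0)) ^ n)%R with x in L.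
  2:{ replace ((1 - 0) * (1 - 0))%R with 1%R by ring. rewrite pow1. ring. }
  refine (is_lim_seq_le _ _ x y _ L (is_lim_seq_const y)).
  intro k. apply H. 
  assert (1 < INR (S (S k)))%R by (rewrite !S_INR; pose proof (pos_INR k); lra).
  assert (0 < / INR (S (S k)))%R by (apply Rinv_0_lt_compat; lra).
  assert (/ INR (S (S k)) < 1)%R by (rewrite <- Rinv_1; apply Rinv_lt_contravar; lra).
  lra.
Qed.

Section LogDerivative.
Variables (alpha : R) (b : nat -> C).
Hypothesis Ha : (0 < alpha <= 2)%R.
Hypothesis Hb : converges b.
Hypothesis Hb0 : b 0%nat = 1.
Hypothesis Hnz : forall z, (Cmod z < 1)%R -> power_sum b z <> 0.
Hypothesis Hre : forall z, (Cmod z < 1)%R -> (Re (z * power_sum (derived b) z / power_sum b z)%C < alpha / 2)%R.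

Let q (z : C) := power_sum (derived b) z / power_sum b z.
Let phi (z : C) := z * q z.

Lemma holomorphic_q : holomorphic 1 q.
Proof.
  apply holomorphic_mult. apply holomorphic_power_sum, converges_derived, Hb. apply holomorphic_inv; auto. now apply holomorphic_power_sum.
Qed.
Lemma holomorphic_phi : holomorphic 1 phi.
Proof. apply holomorphic_mult. apply holomorphic_id. apply holomorphic_q. Qed.

Lemma phi_re z : (Cmod z < 1)%R -> (Re (phi z) <= alpha / 2)%R.
Proof.
  intros Hz. specialize (Hre z Hz). unfold phi, q.
  replace (z * (power_sum (derived b) z / power_sum b z)) with (z * power_sum (derived b) z / power_sum b z); [lra|].
  unfold Cdiv. ring.
Qed.

(** The coefficients of b_0 + ... + b_(m-1) z^(m-1) + c z^m. *)
Let test (m : nat) (c : C) (k : nat) : C := if Nat.eq_dec k m then c else b k.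

Lemma test_poly m c z n : (n <= m)%nat -> poly_sum (test m c) n z = poly_sum b n z.
Proof.
  induction n; intros Hn; simpl; auto. rewrite IHn by lia. unfold test.
  destruct (Nat.eq_dec n m); [lia|reflexivity].
Qed.

(** Since [phi] times the whole series is [z h'], and [phi] vanishes at [0], changing the
    series from order [m] on alters [phi] times it only from order [m + 1] on. *)
Lemma phi_test m c : exists E, holomorphic 1 E /\ forall w, (Cmod w < 1)%R ->
  phi w * poly_sum (test m c) (S m) w = poly_sum (fun k => RtoC (INR k) * b k) (S m) w + w ^ S m * E w.
Proof.
  set (kb := fun k => RtoC (INR k) * b k).
  assert (Hkb : converges kb) by now apply converges_mulk.
  exists (fun w => power_sum (fun k => kb (S m + k)%nat) w + q w * (c + (- (1)) * power_sum (fun k => b (m + k)%nat) w)).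
  split.
  - apply holomorphic_plus. now apply holomorphic_power_sum, converges_shiftn.
    apply holomorphic_mult. apply holomorphic_q. apply holomorphic_plus. apply holomorphic_const.
    apply holomorphic_mult. apply holomorphic_const. now apply holomorphic_power_sum, converges_shiftn.
  - intros w Hw.
    assert (E1 : phi w * power_sum b w = power_sum kb w).
    { rewrite (power_sum_step kb); auto. unfold phi, q.
      change (fun k => kb (S k)) with (derived b). unfold kb at 1. simpl INR.
      field. now apply Hnz. }
    rewrite (power_sum_split kb (S m) w Hkb Hw) in E1.
    rewrite (power_sum_split b m w Hb Hw) in E1.
    simpl poly_sum at 1. rewrite test_poly by lia. unfold test.
    destruct (Nat.eq_dec m m); [|lia].
    set (T1 := power_sum (fun k => kb (S m + k)%nat) w) in *.
    set (T2 := power_sum (fun k => b (m + k)%nat) w) in *.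
    replace (phi w * (poly_sum b m w + c * w ^ m)) with
      (phi w * (poly_sum b m w + w ^ m * T2) + phi w * (c - T2) * w ^ m) by ring.
    rewrite E1. unfold phi. rewrite (Cpow_S w m). ring.
Qed.

Lemma clunie_inequality m c r : (0 < r < 1)%R ->
  (Re (poly_sum (fun k => RtoC (INR k) * b k * Cconj (test m c k))%C (S m) (RtoC (r * r))) <=
   alpha / 2 * Re (poly_sum (fun k => test m c k * Cconj (test m c k))%C (S m) (RtoC (r * r))))%R.
Proof.
  intros Hr. destruct (phi_test m c) as [E [HE Hphi]].
  rewrite <- (mean_pairing 1 r Hr (fun w => phi w * poly_sum (test m c) (S m) w) E
    (fun k => RtoC (INR k) * b k) (test m c) (S m) HE Hphi).
  rewrite <- (mean_pairing 1 r Hr (poly_sum (test m c) (S m)) (fun _ => 0)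
    (test m c) (test m c) (S m) (holomorphic_const _ _)) by (intros; ring).
  apply (halfplane_pairing (fun t => phi (circ r t)) (fun t => poly_sum (test m c) (S m) (circ r t))).
  - apply (holomorphic_ccont 1); [apply holomorphic_phi|lra].
  - apply (holomorphic_ccont 1); [apply holomorphic_poly|lra].
  - intro t. apply phi_re. rewrite Cmod_circ; lra.
Qed.

(** In [clunie_inequality] the terms of order [1 <= k < m] have the good sign because
    [alpha / 2 <= 1 <= k], and the term of order [0] contributes [alpha / 2]. With [|c| =
    1] and [c] aligned with [b m], what remains is [m |b m| <= alpha] up to powers of the
    radius. *)
Lemma coefficient_bound m : (INR m * Cmod (b m) <= alpha)%R.
Proof.
  destruct m as [|m]; [simpl; lra|].
  destruct (Ceq_dec (b (S m)) 0) as [E|Nb].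
  { rewrite E, Cmod_0. lra. }
  set (M := S m) in *. set (B := Cmod (b M)).
  assert (HB : (0 < B)%R) by now apply Cmod_gt_0.
  apply (le_of_pow_limit _ _ M).
  { apply Rmult_le_pos; [apply pos_INR|lra]. }
  intros r Hr. set (x := (r * r)%R). assert (Hx : (0 < x < 1)%R) by (unfold x; nra).
  (* the unit vector that turns Re (b_M conj(c)) into |b_M| *)
  set (c := RtoC (/ B) * b M).
  pose proof (clunie_inequality M c r Hr) as H. fold x in H.
  assert (Low : forall n, (n <= m)%nat ->
    (alpha / 2 * Re (poly_sum (fun k => test M c k * Cconj (test M c k))%C (S n) (RtoC x)) - alpha / 2
     <= Re (poly_sum (fun k => RtoC (INR k) * b k * Cconj (test M c k))%C (S n) (RtoC x)))%R).
  { assert (TB : forall k, (k <= m)%nat -> test M c k = b k).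
    { intros k Hk. unfold test. destruct (Nat.eq_dec k M); [unfold M in *; lia|reflexivity]. }
    induction n; intros Hn.
    - simpl. rewrite !TB by lia. rewrite Hb0. unfold Re, Cplus, Cmult, RtoC, Cconj; simpl. lra.
    - specialize (IHn ltac:(lia)). rewrite !(poly_S _ (S n)). rewrite !(TB (S n)) by lia.
      rewrite !re_plus, <- RtoC_pow.
      replace (RtoC (INR (S n)) * b (S n) * Cconj (b (S n))) with
        (RtoC (INR (S n)) * (b (S n) * Cconj (b (S n)))) by ring.
      rewrite <- Cmod2_conj, !re_scal_r, !Re_RtoC.
      assert (1 <= INR (S n))%R by (rewrite S_INR; pose proof (pos_INR n); lra).
      assert (0 <= Cmod (b (S n)) ^ 2 * x ^ S n)%R
        by (apply Rmult_le_pos; [apply pow2_ge_0|apply pow_le; lra]).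
      nra. }
  specialize (Low m (Nat.le_refl m)).
  assert (Ex : forall e, poly_sum e (S M) (RtoC x) = poly_sum e M (RtoC x) + e M * RtoC (x ^ M))
    by (intro e; now rewrite poly_S, RtoC_pow).
  rewrite !Ex in H. rewrite !re_plus in H.
  assert (TM : test M c M = c) by (unfold test; destruct (Nat.eq_dec M M); [reflexivity|lia]).
  rewrite !TM in H. unfold M in Low at 1. 
  assert (c1 : c * Cconj c = 1).
  { rewrite <- Cmod2_conj. unfold c. rewrite Cmod_mult, Cmod_R, Rabs_pos_eq.
    fold B. replace (/ B * B)%R with 1%R by (field; lra). f_equal. ring.
    left. now apply Rinv_0_lt_compat. }
  assert (c2 : RtoC (INR M) * b M * Cconj c = RtoC (INR M * B)).
  { unfold c. rewrite Cmult_conj.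
    replace (Cconj (RtoC (/ B))) with (RtoC (/ B)) by (unfold Cconj, RtoC; simpl; f_equal; ring).
    replace (RtoC (INR M) * b M * (RtoC (/ B) * Cconj (b M))) with
      (RtoC (INR M) * (b M * Cconj (b M)) * RtoC (/ B)) by ring.
    rewrite <- Cmod2_conj. fold B. rewrite <- !RtoC_mult. f_equal. field. lra. }
  rewrite c1, c2 in H. rewrite !re_scal_r, !Re_RtoC in H.
  assert (0 < x ^ M <= 1)%R.
  { split; [apply pow_lt; lra|]. rewrite <- (pow1 M). apply pow_incr. lra. }
  fold M in Low. nra.
Qed.


(** On the circle of radius [r] put [W = z / (zeta - z)]. It is the conjugate of the
    values of a holomorphic function [V] with [V 0 = 0], so [W] and [Cconj phi * W] have
    mean zero, while [phi * W] has mean [phi z] by Cauchy's formula. Therefore [phi z] is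
    the mean of [-2 (alpha / 2 - Re phi) W], where [|W| <= |z| / (r - |z|)] and the
    nonnegative factor has mean [alpha / 2]. *)
Lemma schwarz_bound_smaller_disk z r : (Cmod z < r)%R -> (r < 1)%R ->
  (Cmod (phi z) * (r - Cmod z) <= alpha * Cmod z)%R.
Proof.
  intros Hz Hr. set (s := Cmod z) in *. assert (Hs : (0 <= s)%R) by apply Cmod_ge_0.
  destruct (Rle_lt_or_eq_dec 0 s Hs) as [Ps|Es].
  2:{ assert (z = 0) by (apply Cmod_eq_0; fold s; auto). subst z.
      unfold phi at 1. rewrite Cmult_0_l, Cmod_0. nra. }
  (* V has its pole at distance r^2 / s from the origin, outside the circle of radius r. *)
  set (rho := Rmin 1 (r * r / s)).
  assert (Hrr : (r < r * r / s)%R) by (apply Rlt_div_r; nra).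
  assert (Hrho : (0 < r < rho)%R) by (split; [lra|]; unfold rho; apply Rmin_case; lra).
  assert (Hin : forall w, (Cmod w < rho)%R -> (Cmod w < 1)%R).
  { intros w Hw. eapply Rlt_le_trans; [exact Hw|apply Rmin_l]. }
  assert (Hin2 : forall w, (Cmod w < rho)%R -> (Cmod w * s < r * r)%R).
  { intros w Hw. apply Rlt_div_r; auto. eapply Rlt_le_trans; [exact Hw|apply Rmin_r]. }
  set (V := fun w => Cconj z * w * / (RtoC (r * r) + (- Cconj z) * w)).
  assert (HV0 : forall w, (Cmod w < rho)%R -> RtoC (r * r) + (- Cconj z) * w <> 0).
  { intros w Hw E. specialize (Hin2 w Hw).
    assert (E' : RtoC (r * r) = Cconj z * w).
    { replace (Cconj z * w) with (RtoC (r*r) - (RtoC (r * r) + (- Cconj z) * w)) by ring.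
      rewrite E. ring. }
    apply (f_equal Cmod) in E'. rewrite Cmod_R, Cmod_mult, Cmod_conj, Rabs_pos_eq in E' by nra.
    fold s in E'. lra. }
  assert (HV : holomorphic rho V).
  { apply holomorphic_mult. apply holomorphic_mult. apply holomorphic_const. apply holomorphic_id.
    apply holomorphic_inv; auto. apply holomorphic_plus. apply holomorphic_const.
    apply holomorphic_mult. apply holomorphic_const. apply holomorphic_id. }
  assert (Hphi : holomorphic rho phi).
  { destruct holomorphic_phi as [F' HF]. exists F'. intros w Hw. apply HF. auto. }
  set (W := fun t => Cconj (V (circ r t))).
  assert (Hne : forall t, circ r t - z <> 0) by (intro t; apply (circ_neq rho r z); auto).
  assert (HW : forall t, W t = z / (circ r t - z)).
  { intro t. unfold W, V.
    rewrite Cmult_conj, Cinv_conj, Cplus_conj, !Cmult_conj, Copp_conj, !Cconj_conj by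
      (apply HV0; rewrite Cmod_circ; lra).
    pose proof (circ_conj_pow rho r Hrho t 1) as E. cbn [Cpow pow] in E.
    rewrite !Cmult_1_r, Rmult_1_r in E.
    replace (Cconj (RtoC (r * r))) with (circ r t * Cconj (circ r t))
      by (rewrite E; unfold Cconj, RtoC; simpl; f_equal; ring).
    assert (Cconj (circ r t) <> 0).
    { intro X. apply (f_equal Cmod) in X. rewrite Cmod_conj, Cmod_circ, Cmod_0 in X; lra. }
    replace (circ r t * Cconj (circ r t) + - z * Cconj (circ r t)) with
      ((circ r t - z) * Cconj (circ r t)) by ring.
    field. auto. }
  assert (CV : ccont (fun t => V (circ r t))) by (apply (holomorphic_ccont rho); auto; lra).
  assert (CW : ccont W) by now apply ccont_conj.
  assert (Cp : ccont (fun t => phi (circ r t))) by (apply (holomorphic_ccont rho); auto; lra).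
  assert (V0 : V 0 = 0) by (unfold V; ring).
  assert (C0 : Cconj 0 = 0) by (unfold Cconj, RtoC; simpl; f_equal; ring).
  assert (p0 : phi 0 = 0) by (unfold phi; ring).
  assert (M1 : cmean W = 0).
  { unfold W. rewrite cmean_conj, (holomorphic_mean rho r V HV Hrho), V0; auto. }
  assert (M2 : cmean (fun t => Cconj (phi (circ r t)) * W t) = 0).
  { rewrite (cmean_ext _ (fun t => Cconj (phi (circ r t) * V (circ r t))))
      by (intro; unfold W; now rewrite Cmult_conj).
    rewrite cmean_conj by now apply ccont_mult.
    rewrite (holomorphic_mean rho r (fun w => phi w * V w)); auto.
    - now rewrite V0, Cmult_0_r.
    - now apply holomorphic_mult. }
  assert (M3 : cmean (fun t => phi (circ r t) * W t) = phi z).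
  { destruct Hphi as [F' HF].
    pose proof (cauchy_homotopy rho r phi F' z HF Hrho Hz) as H.
    rewrite (cmean_ext (fun t => circ r t / (circ r t - z)) (fun t => 1 + W t)) in H
      by (intro t; rewrite HW; field; apply Hne).
    rewrite (cmean_ext _ (fun t => phi (circ r t) + phi (circ r t) * W t)) in H
      by (intro t; rewrite HW; field; apply Hne).
    rewrite (cmean_plus _ _ Cp (ccont_mult _ _ Cp CW)), (cmean_plus _ _ (ccont_const 1) CW) in H.
    rewrite cmean_const, M1 in H.
    rewrite (mean_value rho r phi F' HF Hrho), p0 in H.
    replace (phi z) with (phi z * (1 + 0)) by ring. rewrite <- H. ring. }
  set (P := fun t => (alpha / 2 + (-1) * Re (phi (circ r t)))%R).
  assert (CP : rcont P).
  { intro t. unfold P.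
    apply (continuous_plus (U := R_UniformSpace) (V := R_NormedModule)). apply continuous_const.
    apply (rcont_scal (-1)). now apply ccont_Re. }
  assert (P0 : forall t, (0 <= P t)%R).
  { intro t. unfold P. pose proof (phi_re (circ r t) ltac:(rewrite Cmod_circ; lra)). lra. }
  assert (MP : rmean P = (alpha / 2)%R).
  { unfold P. rewrite rmean_plus, rmean_const, rmean_scal.
    - assert (X : rmean (fun t => Re (phi (circ r t))) = 0%R).
      { rewrite <- (Re_cmean (fun t => phi (circ r t))).
        rewrite (holomorphic_mean rho r phi Hphi Hrho), p0. reflexivity. }
      rewrite X. ring.
    - now apply ccont_Re.
    - intro t. apply continuous_const.
    - now apply rcont_scal, ccont_Re. }
  assert (E : phi z = cmean (fun t => RtoC (- 2 * P t) * W t)).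
  { rewrite (cmean_ext _ (fun t => phi (circ r t) * W t +
      (Cconj (phi (circ r t)) * W t + RtoC (- alpha) * W t))).
    - assert (K1 : ccont (fun t => phi (circ r t) * W t)) by now apply ccont_mult.
      assert (K2 : ccont (fun t => Cconj (phi (circ r t)) * W t))
        by (apply ccont_mult; auto; now apply ccont_conj).
      assert (K3 : ccont (fun t => RtoC (- alpha) * W t))
        by (apply ccont_mult; auto; apply ccont_const).
      rewrite (cmean_plus _ _ K1 (ccont_plus _ _ K2 K3)), (cmean_plus _ _ K2 K3),
        (cmean_scal _ _ CW), M1, M2, M3. ring.
    - intro t.
      replace (phi (circ r t) * W t + (Cconj (phi (circ r t)) * W t + RtoC (- alpha) * W t))
       with ((phi (circ r t) + Cconj (phi (circ r t)) + RtoC (- alpha)) * W t) by ring.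
      f_equal. unfold P. destruct (phi (circ r t)) as [u v].
      unfold RtoC, Cconj, Cplus, Re; simpl. f_equal; field. }
  assert (B : (Cmod (phi z) <= rmean (fun t => (2 * (s / (r - s))) * P t))%R).
  { rewrite E. apply Cmod_cmean_le.
    - apply ccont_mult; auto. intro t. apply (continuous_C_pair (T := R_UniformSpace)); simpl.
      + apply (rcont_scal (-2) P CP).
      + apply continuous_const.
    - now apply rcont_scal.
    - intro t. rewrite Cmod_mult, Cmod_R, HW, Cmod_div by apply Hne. fold s.
      rewrite Rabs_left1 by (pose proof (P0 t); lra).
      assert (L : (r - s <= Cmod (circ r t - z))%R).
      { pose proof (Cmod_lower (circ r t) (circ r t - z)) as L.
        replace (circ r t - z - circ r t) with (- z) in L by ring.
        rewrite Cmod_opp, Cmod_circ in L by lra. exact L. }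
      replace (2 * (s / (r - s)) * P t)%R with (- (-2 * P t) * (s / (r - s)))%R by ring.
      apply Rmult_le_compat_l; [pose proof (P0 t); lra|].
      apply Rmult_le_compat_l; [lra|]. apply Rinv_le_contravar; lra. }
  rewrite rmean_scal, MP in B by assumption.
  apply Rle_trans with ((2 * (s / (r - s)) * (alpha / 2)) * (r - s))%R.
  - apply Rmult_le_compat_r; lra.
  - right. field. lra.
Qed.

Lemma z_log_derivative_bound z : (Cmod z < 1)%R -> (Cmod (phi z) * (1 - Cmod z) <= alpha * Cmod z)%R.
Proof.
  intros Hz. pose proof (Cmod_ge_0 z) as Hs. pose proof (Cmod_ge_0 (phi z)) as HX.
  set (s := Cmod z) in *. set (X := Cmod (phi z)) in *.
  apply Rnot_lt_le. intro L.
  set (eta := (X * (1 - s) - alpha * s)%R) in *.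
  assert (He : (0 < eta)%R) by (unfold eta; lra).
  (* so small that the bound on the disk of radius 1 - d already contradicts eta > 0 *)
  set (d := Rmin ((1 - s) / 2) (eta / (2 * (X + 1)))).
  assert (Hd : (0 < d)%R).
  { unfold d. apply Rmin_case; [lra|]. apply Rdiv_lt_0_compat; lra. }
  assert (d <= (1 - s) / 2)%R by apply Rmin_l.
  assert (Hd2 : (d <= eta / (2 * (X + 1)))%R) by apply Rmin_r.
  apply Rle_div_r in Hd2; [|lra].
  pose proof (schwarz_bound_smaller_disk z (1 - d)%R ltac:(fold s; lra) ltac:(lra)) as H1.
  fold s in H1. fold X in H1. unfold eta in *. nra.
Qed.

(** Away from [0] divide the bound on [phi] by [|z|]; at [0] the value is the coefficient
    [b 1]. *)
Lemma log_derivative_bound z : (Cmod z < 1)%R -> (Cmod (q z) * (1 - Cmod z) <= alpha)%R.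
Proof.
  intros Hz. destruct (Ceq_dec z 0) as [E|N].
  - subst z. unfold q. rewrite !power_sum_0, Hb0; auto; [|now apply converges_derived].
    unfold derived. rewrite Cmod_0. pose proof (coefficient_bound 1) as H. simpl INR in *.
    rewrite Cmod_div, Cmod_mult, Cmod_R, Rabs_R1; [lra|].
    intro X. apply RtoC_inj in X. lra.
  - apply (proj1 (Cmod_gt_0 _)) in N. pose proof (z_log_derivative_bound z Hz) as H. unfold phi in H.
    rewrite Cmod_mult in H. nra.
Qed.

(** Along the segment from [0] to [z] the function ln |h|^2 - 2 alpha ln (1 - t |z|) of t
    is nondecreasing, by the bound on the logarithmic derivative, and it vanishes at [t =
    0]. *)
Lemma half_plane_lower_bound z : (Cmod z < 1)%R -> (Rpower (1 - Cmod z) alpha <= Cmod (power_sum b z))%R.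
Proof.
  intros Hz. pose proof (Cmod_ge_0 z) as Hs. set (s := Cmod z) in *.
  set (c := fun t : R => power_sum b (RtoC t * z)).
  set (N := fun t : R => (Re (c t) * Re (c t) + Im (c t) * Im (c t))%R).
  assert (Hin : forall t, (0 <= t <= 1)%R -> (Cmod (RtoC t * z) < 1)%R).
  { intros t Ht. rewrite Cmod_mult, Cmod_R, Rabs_pos_eq by lra. fold s. nra. }
  assert (NM : forall t, N t = (Cmod (c t) * Cmod (c t))%R).
  { intro t. replace (Cmod (c t) * Cmod (c t))%R with (Cmod (c t) ^ 2)%R by ring.
    rewrite Cmod2_alt. unfold N. ring. }
  assert (NP : forall t, (0 <= t <= 1)%R -> (0 < N t)%R).
  { intros t Ht. rewrite NM. pose proof (proj1 (Cmod_gt_0 _) (Hnz _ (Hin t Ht))). unfold c. nra. }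
  set (dN := fun t : R => (2 * Re (Cconj (c t) * (power_sum (derived b) (RtoC t * z) * z))%C)%R).
  assert (HN : forall t, (0 <= t <= 1)%R -> is_derive N t (dN t)).
  { intros t Ht.
    assert (D1 : curve_derive (fun u => RtoC u * z) t z).
    { split; unfold Re, Im, RtoC, Cmult; simpl; auto_derive; auto; ring. }
    destruct (curve_derive_comp (power_sum b) _ t _ _ (power_sum_is_derive b _ Hb (Hin t Ht)) D1) as [X Y].
    fold c in X, Y.
    pose proof (is_derive_plus _ _ _ _ _
      (Derive.is_derive_mult _ _ _ _ _ X X) (Derive.is_derive_mult _ _ _ _ _ Y Y)) as Z.
    unfold N, dN. eapply is_derive_ext; [|eapply eq_ind_r with (P := is_derive _ t); [exact Z|]].
    - reflexivity.
    - unfold plus, c, Re, Im, Cmult, Cconj. cbn [fst snd].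
      simpl. ring. }
  assert (HdN : forall t, (0 <= t <= 1)%R -> (- (2 * alpha * s / (1 - t * s)) * N t <= dN t)%R).
  { intros t Ht. set (w := RtoC t * z). 
    assert (Hw : (Cmod w < 1)%R) by now apply Hin.
    assert (Ew : Cmod w = (t * s)%R)
      by (unfold w; rewrite Cmod_mult, Cmod_R, Rabs_pos_eq; [reflexivity|lra]).
    pose proof (log_derivative_bound w Hw) as Q. rewrite Ew in Q.
    assert (0 < 1 - t * s)%R by lra.
    assert (E : Cconj (c t) * (power_sum (derived b) w * z) = (q w * z) * RtoC (N t)).
    { rewrite NM. replace (Cmod (c t) * Cmod (c t))%R with (Cmod (c t) ^ 2)%R by ring.
      rewrite Cmod2_conj. unfold q, c. fold w. field. now apply Hnz. }
    unfold dN. fold w. rewrite E, re_scal_r.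
    assert (L : (- (alpha * s / (1 - t * s)) <= Re (q w * z))%R).
    { pose proof (re_le_Cmod (q w * z)) as R1. rewrite Cmod_mult in R1. fold s in R1.
      assert (Cmod (q w) * s <= alpha * s / (1 - t * s))%R.
      { apply (proj1 (Rle_div_r (Cmod (q w) * s) (alpha * s) (1 - t * s) ltac:(lra))).
        replace (Cmod (q w) * s * (1 - t * s))%R with (Cmod (q w) * (1 - t * s) * s)%R by ring.
        apply Rmult_le_compat_r; auto. }
      apply Rabs_le_between in R1. lra. }
    pose proof (NP t Ht).
    replace (- (2 * alpha * s / (1 - t * s)) * N t)%R with
      (2 * (- (alpha * s / (1 - t * s)) * N t))%R by (field; lra).
    apply Rmult_le_compat_l; [lra|]. apply Rmult_le_compat_r; lra. }
  set (L := fun t : R => (ln (N t) + - (2 * alpha) * ln (1 - t * s))%R).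
  assert (HL : forall t, (0 <= t <= 1)%R -> is_derive L t (dN t / N t + 2 * alpha * s / (1 - t * s))%R).
  { intros t Ht. pose proof (NP t Ht) as P. assert (0 < 1 - t * s)%R by nra.
    pose proof (HN t Ht) as D.
    assert (D1 : is_derive (fun u => ln (N u)) t (dN t / N t)%R).
    { eapply eq_ind_r with (P := is_derive _ t).
      - apply (is_derive_comp (K := R_AbsRing) (V := R_NormedModule) ln N t _ _ (is_derive_ln _ P) D).
      - reflexivity. }
    assert (D2 : is_derive (fun u => - (2 * alpha) * ln (1 - u * s))%R t (2 * alpha * s / (1 - t * s))%R).
    { auto_derive; [lra|]. field. lra. }
    exact (is_derive_plus _ _ _ _ _ D1 D2). }
  assert (Mono : (L 0 <= L 1)%R).
  { destruct (MVT_gen L 0 1 (fun t => dN t / N t + 2 * alpha * s / (1 - t * s))%R) as [u [Hu E]].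
    - intros x. rewrite Rmin_left, Rmax_right by lra. intros Hx. apply HL. lra.
    - intros x. rewrite Rmin_left, Rmax_right by lra. intros Hx.
      apply derivable_continuous_pt. eexists. apply is_derive_Reals, HL. lra.
    - rewrite Rmin_left, Rmax_right in Hu by lra.
      assert (0 <= dN u / N u + 2 * alpha * s / (1 - u * s))%R.
      { pose proof (HdN u Hu) as X. pose proof (NP u Hu).
        assert (- (2 * alpha * s / (1 - u * s)) <= dN u / N u)%R; [|lra].
        apply (proj1 (Rle_div_r _ (dN u) (N u) ltac:(lra))). exact X. }
      nra. }
  assert (L0 : L 0 = 0%R).
  { unfold L. rewrite NM. unfold c. rewrite Cmult_0_l, power_sum_0, Hb0, Cmod_1 by assumption.
    rewrite Rmult_0_l, Rminus_0_r, Rmult_1_r, ln_1. ring. }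
  rewrite L0 in Mono. unfold L in Mono. rewrite NM in Mono. unfold c in Mono.
  rewrite Cmult_1_l, Rmult_1_l in Mono.
  pose proof (proj1 (Cmod_gt_0 _) (Hnz z Hz)) as P.
  rewrite ln_mult in Mono by assumption.
  unfold Rpower. rewrite <- (exp_ln (Cmod (power_sum b z))) by assumption.
  assert (Y : (alpha * ln (1 - s) <= ln (Cmod (power_sum b z)))%R) by lra.
  destruct Y as [Y|Y]; [left; now apply exp_increasing|right; now rewrite Y].
Qed.

End LogDerivative.

(** * The real function I and its least root *)

Local Open Scope R_scope.

Lemma I_fun_continuity alpha beta x : (x < 1) -> continuity_pt (I_fun alpha beta) x.
Proof.
  intros Hx. apply continuity_pt_filterlim.
  assert (H : ex_derive (I_fun alpha beta) x).
  { unfold I_fun, Rpower. auto_derive. split; [|split]; auto; lra. }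
  exact (ex_derive_continuous _ _ H).
Qed.

(** The root is the supremum of the points up to which [F] stays negative; continuity
    rules out both signs there. *)
Lemma least_root (F : R -> R) r0 : (forall x, x < 1 -> continuity_pt F x) ->
  F 0 < 0 -> 0 < r0 < 1 -> 0 <= F r0 ->
  exists rho, is_least_positive_root F rho /\ rho <= r0 /\ (forall r, 0 <= r < rho -> F r < 0).
Proof.
  intros HC H0 Hr0 HF.
  set (E := fun x => 0 <= x <= r0 /\ forall y, 0 <= y <= x -> F y < 0).
  assert (Eb : bound E) by (exists r0; intros x [Hx _]; lra).
  assert (E0 : E 0).
  { split; [lra|]. intros y Hy. replace y with 0 by lra. exact H0. }
  destruct (completeness E Eb (ex_intro _ 0 E0)) as [rho [Hub Hlub]].
  assert (R0 : 0 <= rho) by (apply Hub, E0).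
  assert (R1 : rho <= r0) by (apply Hlub; intros x [Hx _]; lra).
  assert (Neg : forall r, 0 <= r < rho -> F r < 0).
  { intros r Hr. apply Rnot_le_lt. intro L.
    assert (rho <= r); [|lra]. apply Hlub. intros x [Hx HE].
    apply Rnot_lt_le. intro Lx. specialize (HE r ltac:(lra)). lra. }
  assert (Loc : forall x, x < 1 -> F x <> 0 -> exists d, 0 < d /\
     forall y, Rabs (y - x) < d -> 0 < F y * F x).
  { intros x Hx Nx. destruct (HC x Hx (Rabs (F x)) (Rabs_pos_lt _ Nx)) as [d [Hd HH]].
    exists d; split; [exact Hd|]. intros y Hy.
    destruct (Req_dec y x) as [->|Ny]; [nra|].
    assert (X : Rabs (F y - F x) < Rabs (F x)).
    { apply HH. split; [split; [exact I|auto]|exact Hy]. }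
    unfold Rabs in X. destruct (Rcase_abs (F x)), (Rcase_abs (F y - F x)); nra. }
  assert (Fz : F rho = 0).
  { destruct (Rtotal_order (F rho) 0) as [L|[L|G]]; auto; exfalso.
    - assert (rho < r0) by (destruct R1; auto; subst; lra).
      destruct (Loc rho ltac:(lra) ltac:(lra)) as [d [Hd HD]].
      set (x := Rmin r0 (rho + d / 2)).
      assert (Hx : rho < x) by (unfold x; apply Rmin_case; lra).
      assert (x <= r0) by apply Rmin_l. assert (x <= rho + d / 2) by apply Rmin_r.
      assert (HE : E x); [|pose proof (Hub x HE); lra].
      split; [lra|]. intros y Hy. destruct (Rlt_le_dec y rho); [apply Neg; lra|].
      assert (Hd' : Rabs (y - rho) < d) by (apply Rabs_def1; lra).
      specialize (HD y Hd'). nra.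
    - destruct (Req_dec rho 0) as [Z|Z]; [rewrite Z in G; lra|].
      destruct (Loc rho ltac:(lra) ltac:(lra)) as [d [Hd HD]].
      set (y := Rmax 0 (rho - d / 2)).
      assert (0 <= y) by apply Rmax_l. assert (rho - d / 2 <= y) by apply Rmax_r.
      assert (y < rho) by (unfold y; apply Rmax_case; lra).
      assert (Hd' : Rabs (y - rho) < d) by (apply Rabs_def1; lra).
      specialize (HD y Hd'). specialize (Neg y ltac:(lra)). nra. }
  exists rho. split; [|auto].
  split; [|split; auto].
  - split; [|lra]. destruct R0 as [|Z]; auto. exfalso. subst rho. lra.
  - intros s Hs Es. apply Rnot_lt_le. intro L. specialize (Neg s ltac:(lra)). lra.
Qed.

Lemma ln_1_minus_le r : r < 1 -> ln (1 - r) <= - r.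
Proof.
  intros H. rewrite <- (ln_exp (- r)).
  pose proof (exp_ineq1_le (- r)).
  destruct (Req_dec (1 - r) (exp (-r))) as [->|N]; [lra|].
  left. apply ln_increasing; lra.
Qed.

(** Equals the sum over [k >= 2] of [alpha r^k / k], the largest possible tail of a
    derivative whose coefficients satisfy [k |b_k| <= alpha]. *)
Definition tail_majorant (alpha r : R) : R := - alpha * ln (1 - r) - alpha * r.

(** Bounds the modulus of the derivative of a section from below at distance [r] from the
    origin. *)
Definition section_minorant (alpha r : R) : R :=
  Rpower (1 - r) alpha - tail_majorant alpha r.

Section RealBounds.
Variables alpha beta : R.
Hypothesis Ha : 0 < alpha <= 1.
Hypothesis Hb : 0 <= beta < 1.

Local Notation A := (tail_majorant alpha).
Local Notation D := (section_minorant alpha).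

(** How the equation of the radius arises: this is [(1 - r) D r] times the lower bound for
    the real part of the convexity quotient minus [beta]. *)
Lemma I_fun_decomp r :
  - I_fun alpha beta r =
  D r * ((1 - beta) * (1 - r) - alpha * r) - alpha * r * A r - alpha * (r * r).
Proof. unfold section_minorant, tail_majorant, I_fun. ring. Qed.

Lemma A_nonneg r : r < 1 -> 0 <= A r.
Proof. intros H. unfold tail_majorant. pose proof (ln_1_minus_le r H). nra. Qed.

Let r0 := (1 - beta) / (1 - beta + alpha).
Lemma r0_bounds : 0 < r0 < 1.
Proof.
  unfold r0. split; [apply Rdiv_lt_0_compat; lra|].
  apply (Rmult_lt_reg_r (1 - beta + alpha)); [lra|]. field_simplify; lra.
Qed.

(** At [r0] the factor of [D] in [I_fun_decomp] vanishes and the remaining terms make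
    [I_fun] nonnegative, so the least root is at most [r0]. Below it that factor is
    positive, and negativity of [I_fun] forces [D > 0]. *)
Lemma exists_least_root : exists rho, is_least_positive_root (I_fun alpha beta) rho /\
  forall r, 0 <= r < rho -> I_fun alpha beta r < 0 /\ 0 < D r.
Proof.
  pose proof r0_bounds as H0.
  assert (Hr0 : 0 <= I_fun alpha beta r0).
  { pose proof (I_fun_decomp r0) as E.
    replace ((1 - beta) * (1 - r0) - alpha * r0) with 0 in E by (unfold r0; field; lra).
    pose proof (A_nonneg r0 ltac:(lra)).
    assert (0 <= alpha * r0 * A r0) by (apply Rmult_le_pos; [apply Rmult_le_pos; lra|lra]).
    assert (0 <= alpha * (r0 * r0)) by nra. lra. }
  destruct (least_root (I_fun alpha beta) r0) as [rho [Hl [Hle Hneg]]]; auto.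
  - intros x Hx. now apply I_fun_continuity.
  - unfold I_fun. rewrite Rminus_0_r, ln_1. unfold Rpower. rewrite ln_1, Rmult_0_r, exp_0. nra.
  - exists rho. split; [exact Hl|]. intros r Hr. specialize (Hneg r Hr). split; [exact Hneg|].
    pose proof (I_fun_decomp r) as E. pose proof (A_nonneg r ltac:(lra)).
    assert (0 < (1 - beta) * (1 - r) - alpha * r).
    { assert (Hlt : r < r0) by lra. unfold r0 in Hlt. apply Rlt_div_r in Hlt; lra. }
    assert (0 <= alpha * r * A r) by (apply Rmult_le_pos; [apply Rmult_le_pos; lra|lra]).
    assert (0 <= alpha * (r * r)) by nra. nra.
Qed.
End RealBounds.

(** Both sides vanish at [0], and the derivative of the left one is a geometric sum below
    [r / (1 - r)], the derivative of the right one. *)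
Lemma log_tail_bound r N : 0 <= r < 1 ->
  sum_n (fun k => if Nat.leb 2 k then r ^ k / INR k else 0) N <= - ln (1 - r) - r.
Proof.
  intros Hr.
  set (f := fun k (x : R) => if Nat.leb 2 k then x ^ k / INR k else 0).
  set (df := fun k (x : R) => if Nat.leb 2 k then x ^ (pred k) else 0).
  set (L := fun x => - ln (1 - x) - x - sum_n (fun k => f k x) N).
  assert (HS : forall x, is_derive (fun x => sum_n (fun k => f k x) N) x (sum_n (fun k => df k x) N)).
  { intro x. apply (is_derive_sum_n (K := R_AbsRing) (V := R_NormedModule) f N x (fun k => df k x)).
    intros k _. unfold f, df. destruct (Nat.leb_spec 2 k).
    - assert (INR k <> 0) by (apply not_0_INR; lia).
      auto_derive; auto. field. auto.
    - exact (is_derive_const (K := R_AbsRing) (V := R_NormedModule) 0 x). }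
  assert (HG : forall x, 0 <= x < 1 -> (1 - x) * sum_n (fun k => df k x) N <= x).
  { assert (X : forall x M, (1 - x) * sum_n (fun k => df k x) (S M) = x - x ^ S M).
    { intros x M. induction M.
      - rewrite sum_Sn, sum_O. unfold df, plus; simpl. ring.
      - rewrite sum_Sn. change plus with Rplus.
        rewrite Rmult_plus_distr_l, IHM. unfold df. simpl. ring. }
    intros x Hx. destruct N as [|M].
    - rewrite sum_O. unfold df. simpl. lra.
    - rewrite X. pose proof (pow_le x (S M) (proj1 Hx)). lra. }
  assert (HL : forall x, 0 <= x <= r -> is_derive L x (/ (1 - x) - 1 - sum_n (fun k => df k x) N)).
  { intros x Hx. unfold L.
    assert (D1 : is_derive (fun x => - ln (1 - x) - x) x (/ (1 - x) - 1)).
    { auto_derive; [lra|]. field. lra. }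
    exact (is_derive_minus _ _ _ _ _ D1 (HS x)). }
  assert (L0 : L 0 = 0).
  { unfold L. replace (1 - 0) with 1 by ring. rewrite ln_1.
    assert (Z : sum_n (fun k => f k 0) N = 0).
    { rewrite (sum_n_ext _ (fun _ => 0)).
      - rewrite sum_n_const. apply Rmult_0_r.
      - intro k. unfold f. destruct (Nat.leb_spec 2 k); auto. rewrite pow_i by lia. apply Rmult_0_l. }
    rewrite Z. ring. }
  assert (H : L 0 <= L r).
  { destruct (MVT_gen L 0 r (fun x => / (1 - x) - 1 - sum_n (fun k => df k x) N)) as [u [Hu E]].
    - intros x. rewrite Rmin_left, Rmax_right by lra. intros Hx. apply HL. lra.
    - intros x. rewrite Rmin_left, Rmax_right by lra. intros Hx.
      apply derivable_continuous_pt. eexists. apply is_derive_Reals, HL. lra.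
    - rewrite Rmin_left, Rmax_right in Hu by lra.
      assert (sum_n (fun k => df k u) N <= / (1 - u) - 1).
      { replace (/ (1 - u) - 1) with (u / (1 - u)) by (field; lra).
        apply (proj1 (Rle_div_r _ u (1 - u) ltac:(lra))).
        rewrite Rmult_comm. apply HG. lra. }
      nra. }
  rewrite L0 in H.
  change (0 <= - ln (1 - r) - r
    - sum_n (fun k => if Nat.leb 2 k then r ^ k / INR k else 0) N) in H. lra.
Qed.

Local Open Scope C_scope.

(** * Convexity of sections *)

Lemma locally_disk (rho : R) (z : C) (P : C -> Prop) : (Cmod z < rho)%R ->
  (forall w, (Cmod w < rho)%R -> P w) -> @locally (AbsRing_UniformSpace C_AbsRing) z P.
Proof.
  intros Hz HP. assert (H : (0 < rho - Cmod z)%R) by lra.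
  exists (mkposreal _ H). intros w Hw. apply HP.
  change (Cmod (w - z) < rho - Cmod z)%R in Hw.
  replace w with ((w - z) + z) by ring.
  eapply Rle_lt_trans; [apply Cmod_triangle|]. lra.
Qed.

Lemma is_derive_of_power_sum g c : converges c -> (forall z, (Cmod z < 1)%R -> g z = power_sum c z) ->
  forall z, (Cmod z < 1)%R -> is_derive g z (power_sum (derived c) z).
Proof.
  intros Hc Hg z Hz. apply (is_derive_ext_loc (power_sum c)).
  - apply (locally_disk 1); auto. intros w Hw. symmetry. auto.
  - now apply power_sum_is_derive.
Qed.

Lemma C_derive_of_power_sum g c : converges c -> (forall z, (Cmod z < 1)%R -> g z = power_sum c z) ->
  forall z, (Cmod z < 1)%R -> C_derive g z = power_sum (derived c) z.
Proof.
  intros Hc Hg z Hz. apply is_C_derive_unique. now apply is_derive_of_power_sum.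
Qed.

Lemma converges_le a b : converges a -> (forall k, Cmod (b k) <= Cmod (a k))%R -> converges b.
Proof.
  intros Ha H r Hr. destruct (Ha r Hr) as [M HM]. exists M. intro k.
  eapply Rle_trans; [|apply HM]. apply Rmult_le_compat_r; auto. apply pow_le; lra.
Qed.

Definition trunc (n : nat) (a : nat -> C) (k : nat) : C := if Nat.leb k n then a k else 0.

Lemma converges_trunc n a : converges a -> converges (trunc n a).
Proof.
  intros Ha. apply (converges_le a); auto. intro k. unfold trunc.
  destruct (Nat.leb k n); [lra|]. rewrite Cmod_0. apply Cmod_ge_0.
Qed.

Lemma power_sum_minus a b z : converges a -> converges b -> (Cmod z < 1)%R ->
  Cseries (fun k => (a k - b k) * z ^ k) (power_sum a z - power_sum b z).
Proof.
  intros Ha Hb Hz.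
  replace (power_sum a z - power_sum b z) with (power_sum a z + (- (1)) * power_sum b z) by ring.
  eapply Cseries_ext; [|apply Cseries_plus; [|apply Cseries_scal]; now apply power_sum_correct].
  intro k. simpl. ring.
Qed.

Lemma power_sum_mulk b z : converges b -> (Cmod z < 1)%R ->
  power_sum (fun k => RtoC (INR k) * b k) z = z * power_sum (derived b) z.
Proof.
  intros Hb Hz. rewrite power_sum_step; [|now apply converges_mulk|auto].
  simpl INR at 1. change (fun k => RtoC (INR (S k)) * b (S k)) with (derived b). ring.
Qed.

Lemma poly_partial_section (a : nat -> C) n z : a 0%nat = 0 -> a 1%nat = 1 ->
  poly_sum a (S (S n)) z = partial_section a (S n) z.
Proof.
  intros H0 H1. induction n.
  - unfold partial_section. rewrite sum_n_m_zero by lia. simpl. rewrite H0, H1.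
    change zero with (RtoC 0). ring.
  - rewrite poly_S, IHn. unfold partial_section. rewrite (sum_n_Sm _ 2 (S n)) by lia.
    change plus with Cplus. ring.
Qed.

Lemma power_sum_zero (c : nat -> C) (z : C) : (forall k, c k = 0) -> power_sum c z = 0.
Proof.
  intros H. unfold power_sum, Csum.
  rewrite (Series_ext _ (fun _ => 0 * 0)%R) by (intro k; rewrite H, Cmult_0_l; simpl; ring).
  rewrite (Series_ext (fun k => Im (c k * z ^ k)) (fun _ => 0 * 0)%R)
    by (intro k; rewrite H, Cmult_0_l; simpl; ring).
  rewrite Series_scal_l. unfold RtoC. f_equal; ring.
Qed.

Lemma poly_ext (a b : nat -> C) n z : (forall k, (k < n)%nat -> a k = b k) -> poly_sum a n z = poly_sum b n z.
Proof.
  induction n; intros H; simpl; auto. rewrite IHn, H by (intros; try apply H; lia). reflexivity.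
Qed.

(** Treating a section as a power series makes its derivatives instances of
    [C_derive_of_power_sum]. *)
Lemma partial_section_power_sum (a : nat -> C) n z : converges a -> a 0%nat = 0 -> a 1%nat = 1 -> (1 <= n)%nat ->
  (Cmod z < 1)%R -> partial_section a n z = power_sum (trunc n a) z.
Proof.
  intros Ha H0 H1 Hn Hz. destruct n as [|n]; [lia|].
  rewrite (power_sum_split (trunc (S n) a) (S (S n)) z) by (auto; now apply converges_trunc).
  rewrite (power_sum_zero (fun k => trunc (S n) a (S (S n) + k)%nat)).
  - rewrite Cmult_0_r, Cplus_0_r, <- (poly_partial_section a n z H0 H1).
    apply poly_ext. intros k Hk. unfold trunc. destruct (Nat.leb_spec k (S n)); [auto|lia].
  - intro k. unfold trunc. destruct (Nat.leb_spec (S (S n) + k) (S n)); [lia|auto].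
Qed.

Lemma geom_tail r N : (0 <= r < 1)%R ->
  (sum_n (fun k => if Nat.leb 2 k then r ^ k else 0) N <= r * r / (1 - r))%R.
Proof.
  intros Hr. apply (proj1 (Rle_div_r _ (r * r) (1 - r) ltac:(lra))).
  assert (X : forall M, (sum_n (fun k => if Nat.leb 2 k then r ^ k else 0) (S M) * (1 - r) = r * r - r ^ (S (S M)))%R).
  { induction M.
    - rewrite sum_Sn, sum_O. unfold plus; simpl. ring.
    - rewrite sum_Sn. change plus with Rplus. rewrite Rmult_plus_distr_r, IHM. simpl. ring. }
  destruct N as [|M].
  - rewrite sum_O. simpl. nra.
  - rewrite X. pose proof (pow_le r (S (S M)) (proj1 Hr)). lra.
Qed.

(** The coefficients of the difference vanish up to order [n >= 1], and beyond are at most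
    [alpha / k], respectively [alpha] after multiplication by [k]. *)
Lemma tail_bounds alpha b n z :
  (0 < alpha)%R -> converges b -> (forall k, INR k * Cmod (b k) <= alpha)%R ->
  (1 <= n)%nat -> (Cmod z < 1)%R ->
  (Cmod (power_sum b z - power_sum (trunc n b) z) <= tail_majorant alpha (Cmod z))%R /\
  (Cmod (z * (power_sum (derived b) z - power_sum (derived (trunc n b)) z)) <= alpha * (Cmod z * Cmod z / (1 - Cmod z)))%R.
Proof.
  intros Ha Hb Hk Hn Hz. pose proof (Cmod_ge_0 z) as Hz0.
  pose proof (converges_trunc n b Hb) as Ht.
  split.
  - apply (Cseries_bound _ _ _ (power_sum_minus _ _ _ Hb Ht Hz)). intro N.
    apply Rle_trans with (alpha * sum_n (fun k => if Nat.leb 2 k then Cmod z ^ k / INR k else 0)%R N)%R.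
    + rewrite <- (sum_n_scal_l (K := R_AbsRing) (V := R_NormedModule) alpha).
      apply sum_n_le. intro k. 
      change (Cmod ((b k - trunc n b k) * z ^ k)
        <= alpha * (if Nat.leb 2 k then Cmod z ^ k / INR k else 0))%R.
      rewrite Cmod_mult, Cmod_pow. unfold trunc. destruct (Nat.leb_spec k n).
      * replace (b k - b k) with (RtoC 0) by ring. rewrite Cmod_0, Rmult_0_l.
        destruct (Nat.leb_spec 2 k); [|lra].
        apply Rmult_le_pos; [lra|]. apply Rdiv_le_0_compat; [now apply pow_le|apply lt_0_INR; lia].
      * destruct (Nat.leb_spec 2 k); [|lia].
        replace (b k - 0) with (b k) by ring.
        assert (P : (0 < INR k)%R) by (apply lt_0_INR; lia).
        replace (alpha * (Cmod z ^ k / INR k))%R with (alpha / INR k * Cmod z ^ k)%R by (field; lra).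
        apply Rmult_le_compat_r; [now apply pow_le|].
        apply (proj1 (Rle_div_r _ alpha (INR k) P)). rewrite Rmult_comm. apply Hk.
    + unfold tail_majorant. pose proof (log_tail_bound (Cmod z) N (conj Hz0 Hz)). nra.
  - pose proof (converges_mulk _ Hb) as Hb'. pose proof (converges_mulk _ Ht) as Ht'.
    replace (z * (power_sum (derived b) z - power_sum (derived (trunc n b)) z)) with
      (power_sum (fun k => RtoC (INR k) * b k) z - power_sum (fun k => RtoC (INR k) * trunc n b k) z)
      by (rewrite !power_sum_mulk by assumption; ring).
    apply (Cseries_bound _ _ _ (power_sum_minus _ _ _ Hb' Ht' Hz)). intro N.
    apply Rle_trans with (alpha * sum_n (fun k => if Nat.leb 2 k then Cmod z ^ k else 0)%R N)%R.
    + rewrite <- (sum_n_scal_l (K := R_AbsRing) (V := R_NormedModule) alpha).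
      apply sum_n_le. intro k. 
      change (Cmod ((RtoC (INR k) * b k - RtoC (INR k) * trunc n b k) * z ^ k)
        <= alpha * (if Nat.leb 2 k then Cmod z ^ k else 0))%R.
      rewrite Cmod_mult, Cmod_pow. unfold trunc. destruct (Nat.leb_spec k n).
      * replace (RtoC (INR k) * b k - RtoC (INR k) * b k) with (RtoC 0) by ring. rewrite Cmod_0, Rmult_0_l.
        destruct (Nat.leb_spec 2 k); [|lra].
        apply Rmult_le_pos; [lra|now apply pow_le].
      * destruct (Nat.leb_spec 2 k); [|lia].
        replace (RtoC (INR k) * b k - RtoC (INR k) * 0) with (RtoC (INR k) * b k) by ring.
        rewrite Cmod_mult, Cmod_R, Rabs_pos_eq by apply pos_INR.
        apply Rmult_le_compat_r; [now apply pow_le|apply Hk].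
    + pose proof (geom_tail (Cmod z) N (conj Hz0 Hz)). nra.
Qed.

(** With [phi = z * h1 / h] one has [z * p1 / p = phi + (- z (h1 - p1) + phi (h - p)) /
    p], and [|p| >= D]. *)
Lemma quotient_estimate (z h h1 p p1 : C) (u v w D : R) :
  h <> 0 -> (Cmod (z * h1 / h) <= u)%R -> (Cmod (h - p) <= v)%R ->
  (Cmod (z * (h1 - p1)) <= w)%R -> (0 < D)%R -> (D + v <= Cmod h)%R ->
  p <> 0 /\ (1 - u - (u * v + w) / D <= Re (1 + z * p1 / p))%R.
Proof.
  intros Hh Hu Hv Hw HD HDv.
  pose proof (Cmod_lower h p) as L. replace (p - h) with (- (h - p)) in L by ring.
  rewrite Cmod_opp in L.
  assert (Hp : p <> 0) by (apply Cmod_gt_0; lra).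
  split; auto.
  set (phi := z * h1 / h) in *.
  assert (E : z * p1 / p = phi + (- (z * (h1 - p1)) + phi * (h - p)) / p)
    by (unfold phi; field; auto).
  rewrite E, re_plus, re_plus, Re_RtoC.
  pose proof (re_le_Cmod phi) as R1.
  pose proof (re_le_Cmod ((- (z * (h1 - p1)) + phi * (h - p)) / p)) as R2.
  apply Rabs_le_between in R1. apply Rabs_le_between in R2.
  assert (Q : (Cmod ((- (z * (h1 - p1)) + phi * (h - p)) / p) <= (u * v + w) / D)%R).
  { rewrite Cmod_div by auto.
    assert (N : (Cmod (- (z * (h1 - p1)) + phi * (h - p)) <= u * v + w)%R).
    { eapply Rle_trans; [apply Cmod_triangle|]. rewrite Cmod_opp, (Cmod_mult phi).
      pose proof (Rmult_le_compat _ _ _ _ (Cmod_ge_0 phi) (Cmod_ge_0 (h - p)) Hu Hv). lra. }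
    apply Rmult_le_compat; auto. apply Cmod_ge_0.
    - left. apply Rinv_0_lt_compat. lra.
    - apply Rinv_le_contravar; lra. }
  lra.
Qed.

Theorem theorem3p1 :
  forall alpha beta : R,
    (0 < alpha <= 1)%R -> (0 <= beta < 1)%R ->
    exists rhoK : R,
      is_least_positive_root (I_fun alpha beta) rhoK /\
      forall (f : C -> C) (a : nat -> C),
        class_G alpha f -> power_series_expansion f a ->
        forall n : nat, (2 <= n)%nat ->
          convex_of_order_in_disk beta rhoK (partial_section a n).
Proof.
  intros alpha beta Ha Hb.
  destruct (exists_least_root alpha beta Ha Hb) as [rhoK [Hroot Hneg]].
  exists rhoK. split; [exact Hroot|].
  intros f a [[_ [f0 f1]] [_ Hf]] Hexp n Hn.
  pose proof (expansion_converges _ _ Hexp) as Hc.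
  assert (Hfa : forall z, (Cmod z < 1)%R -> f z = power_sum a z) by (intros; now apply expansion_power_sum).
  set (b := derived a). assert (Hcb : converges b) by now apply converges_derived.
  assert (Df : forall z, (Cmod z < 1)%R -> C_derive f z = power_sum b z) by now apply C_derive_of_power_sum.
  assert (DDf : forall z, (Cmod z < 1)%R -> C_derive (C_derive f) z = power_sum (derived b) z)
    by now apply C_derive_of_power_sum.
  assert (z01 : (Cmod 0 < 1)%R) by (rewrite Cmod_0; lra).
  assert (a0 : a 0%nat = 0) by (rewrite <- (power_sum_0 a Hc), <- Hfa; auto).
  assert (b0 : b 0%nat = 1) by (rewrite <- (power_sum_0 b Hcb), <- Df; auto).
  assert (a1 : a 1%nat = 1).
  { rewrite <- b0. unfold b, derived. simpl. ring. }
  assert (Hnz : forall z, (Cmod z < 1)%R -> power_sum b z <> 0).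
  { intros z Hz. rewrite <- Df by auto. now apply Hf. }
  assert (Hre : forall z, (Cmod z < 1)%R -> (Re (z * power_sum (derived b) z / power_sum b z)%C < alpha / 2)%R).
  { intros z Hz. destruct (Hf z Hz) as [_ X]. unfold convexity_quotient in X.
    rewrite Df, DDf in X by auto. rewrite re_plus, Re_RtoC in X. lra. }
  destruct Hroot as [Hrho _].
  set (s := partial_section a n).
  pose proof (converges_trunc n a Hc) as Hct.
  assert (Hs : forall z, (Cmod z < 1)%R -> s z = power_sum (trunc n a) z).
  { intros z Hz. apply partial_section_power_sum; auto. lia. }
  (* Differentiation lowers the degree at which the series is cut. *)
  set (m := pred n).
  assert (Et : forall k, derived (trunc n a) k = trunc m b k).
  { intro k. unfold derived, trunc, b, m. destruct (Nat.leb_spec (S k) n), (Nat.leb_spec k (pred n)); try lia.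
    reflexivity. ring. }
  pose proof (converges_trunc m b Hcb) as Hctb.
  assert (Ds : forall z, (Cmod z < 1)%R -> C_derive s z = power_sum (trunc m b) z).
  { intros z Hz. rewrite (C_derive_of_power_sum s (trunc n a)); auto. now apply power_sum_ext. }
  assert (DDs : forall z, (Cmod z < 1)%R -> C_derive (C_derive s) z = power_sum (derived (trunc m b)) z)
    by now apply C_derive_of_power_sum.
  split; [|split; [split|]].
  - intros z Hz. eexists. apply (is_derive_of_power_sum s (trunc n a)); auto. lra.
  - rewrite Hs, power_sum_0; auto.
  - rewrite Ds, power_sum_0; auto.
  - intros z Hz. assert (Hz1 : (Cmod z < 1)%R) by lra.
    pose proof (Cmod_ge_0 z) as Hz0.
    unfold convexity_quotient. rewrite Ds, DDs by auto.
    destruct (Hneg (Cmod z) (conj Hz0 Hz)) as [HI HD].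
    pose proof (I_fun_decomp alpha beta (Cmod z)) as HI'.
    assert (Ha2 : (0 < alpha <= 2)%R) by lra.
    pose proof (coefficient_bound alpha b Ha2 Hcb b0 Hnz Hre) as Hk.
    destruct (tail_bounds alpha b m z (proj1 Ha) Hcb Hk ltac:(unfold m; lia) Hz1) as [T1 T2].
    pose proof (half_plane_lower_bound alpha b Ha2 Hcb b0 Hnz Hre z Hz1) as Hl.
    pose proof (z_log_derivative_bound alpha b Ha2 Hcb Hnz Hre z Hz1) as Hphi.
    set (r := Cmod z) in *.
    set (A := tail_majorant alpha r) in *.
    set (D := section_minorant alpha r) in *.
    destruct (quotient_estimate z (power_sum b z) (power_sum (derived b) z) (power_sum (trunc m b) z)
      (power_sum (derived (trunc m b)) z) (alpha * r / (1 - r)) A (alpha * (r * r / (1 - r))) D)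
      as [Q1 Q2]; auto.
    + apply (proj1 (Rle_div_r _ (alpha * r) (1 - r) ltac:(lra))).
      replace (z * power_sum (derived b) z / power_sum b z) with (z * (power_sum (derived b) z / power_sum b z))
        by (unfold Cdiv; ring). exact Hphi.
    + unfold D, section_minorant. fold A. lra.
    + split; [exact Q1|]. eapply Rlt_le_trans; [|exact Q2].
      assert (E : (1 - alpha * r / (1 - r) - (alpha * r / (1 - r) * A + alpha * (r * r / (1 - r))) / D
        - beta = (- I_fun alpha beta r) / ((1 - r) * D))%R).
      { rewrite HI'. field. lra. }
      assert (0 < (- I_fun alpha beta r) / ((1 - r) * D))%R.
      { apply Rdiv_lt_0_compat; [lra|]. apply Rmult_lt_0_compat; lra. }
      lra.
Qed.
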